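(* Let $M$ be either $\mathbb{Q}$ (the ordered set of rational numbers) or $\mathbb{QU}_{\prec}$ (the randomly ordered rational Urysohn space). Then every topological $2$-similarity class in $L_0(\mathrm{Aut}(M))$ is meager in $L_0(\mathrm{Aut}(M))^2$.
   Context: $\mathbb{Q}$ is regarded as the structure $(\mathbb{Q},<)$. $\mathbb{QU}_{\prec}$ is the Fra\''iss\'e limit of the class of linearly ordered finite metric spaces with rational distances (so automorphisms are order-preserving isometric bijections). $\mathrm{Aut}(M)$ carries the pointwise convergence topology ($M$ discrete), making it a Polish group. Let $\mu$ be the Lebesgue measure on $[0,1]$. For a Polish group $G$, $L_0(G)$ is the Polish group of all $\mu$-equivalence classes of $\mu$-measurable functions $[0,1]\to G$, with pointwise multiplication and the topology of convergence in measure: a basic neighbourhood of the identity is $\{f\in L_0(G)\colon \mu(\{x\colon f(x)\notin V\})<\epsilon\}$, where $V$ is a neighbourhood of the identity in $G$ and $\epsilon>0$. For a pair $\bar f=(f_1,f_2)$ in a topological group $H$, $\langle\bar f\rangle$ is the subgroup generated by $\{f_1,f_2\}$. The topological $2$-similarity class of $\bar f$ (also called the $2$-dimensional class of topological similarity) is the set of all $\bar g=(g_1,g_2)\in H^2$ such that the map $f_i\mapsto g_i$ extends (necessarily uniquely) to a bi-continuous group isomorphism between $\langle\bar f\rangle$ and $\langle\bar g\rangle$, taken with the subspace topologies. *)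

(* Defs.v *)
From HB Require Import structures.
From mathcomp Require Import all_boot all_order all_algebra generic_quotient.
From mathcomp Require Import all_classical all_reals all_analysis.

Set Implicit Arguments.
Unset Strict Implicit.
Unset Printing Implicit Defensive.

Import Order.TTheory GRing.Theory Num.Theory.
Import numFieldNormedType.Exports.

Local Open Scope classical_set_scope.
Local Open Scope ring_scope.

(* Countable structures in a language L of binary relation symbols. *)
Record relStructure (L : Type) := RelStructure {
  carrier :> countType ;
  rel_of : L -> carrier -> carrier -> Prop }.

Definition embedding (L : Type) (A B : relStructure L) (f : A -> B) : Prop :=
  injective f /\ forall l x y, rel_of l (f x) (f y) <-> rel_of l x y.

Record Aut (L : Type) (M : relStructure L) := MkAut {
  aut_fun :> M -> M ;
  aut_inv : M -> M ;
  aut_funK : cancel aut_fun aut_inv ;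
  aut_invK : cancel aut_inv aut_fun ;
  aut_rel : forall l x y, rel_of l (aut_fun x) (aut_fun y) <-> rel_of l x y }.

(* In a relational language the finite substructures are the finite subsets,
   so an isomorphism between two of them is a partial map f as below; the
   values of f outside A are irrelevant. *)
Definition ultrahomogeneous (L : Type) (M : relStructure L) : Prop :=
  forall (A : set M) (f : M -> M), finite_set A -> {in A &, injective f} ->
    (forall l x y, A x -> A y -> rel_of l (f x) (f y) <-> rel_of l x y) ->
  exists g : Aut M, forall x, A x -> g x = f x.

(* M, countable by its type, is ultrahomogeneous and its age is K. By Fraisse's
   theorem such an M is unique up to isomorphism. *)
Definition is_fraisse_limit (L : Type) (K : relStructure L -> Prop)
    (M : relStructure L) : Prop :=
  ultrahomogeneous M /\
  forall A : relStructure L, K A <->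
    finite_set [set: A] /\ exists f : A -> M, embedding f.

Definition ratOrder : relStructure unit :=
  RelStructure (fun (_ : unit) (x y : rat) => x < y).

(* A rational metric d is coded by the relations d x y = q, for q : rat, so that
   embeddings are the isometric order embeddings. *)
Inductive metricOrderLang := LtSym | DistSym of rat.

Definition is_strict_linear_order (T : Type) (lt : T -> T -> Prop) : Prop :=
  [/\ forall x, ~ lt x x,
      forall x y z, lt x y -> lt y z -> lt x z &
      forall x y, [\/ lt x y, x = y | lt y x]].

Definition is_metric (T : Type) (d : T -> T -> rat) : Prop :=
  [/\ forall x y, 0 <= d x y,
      forall x y, d x y = 0 <-> x = y,
      forall x y, d x y = d y x &
      forall x y z, d x z <= d x y + d y z].

Definition finite_ordered_rational_metric_space
    (A : relStructure metricOrderLang) : Prop :=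
  [/\ finite_set [set: A],
      is_strict_linear_order (@rel_of _ A LtSym) &
      exists2 d : A -> A -> rat, is_metric d &
        forall q x y, @rel_of _ A (DistSym q) x y <-> d x y = q].

Definition is_QU (M : relStructure metricOrderLang) : Prop :=
  is_fraisse_limit finite_ordered_rational_metric_space M.

#[short(type="groupTopologicalType")]
HB.structure Definition GroupTopological := {H of Group H & Topological H}.

(* Second countability is the only consequence of being Polish that is needed to
   make L0 G below a group (products of Borel maps are Borel). *)
HB.mixin Record isSecondCountableTopGroup G
    of Group G & PointedTopological G := {
  mulg_continuous : continuous (fun p : G * G => (p.1 * p.2)%g) ;
  invg_continuous : continuous (fun x : G => x^-1%g) ;
  second_countableG : @second_countable G }.

#[short(type="scTopGroupType")]
HB.structure Definition SecondCountableTopGroup :=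
  {G of Group G & PointedTopological G & isSecondCountableTopGroup G}.

Section AutGroup.
Context (L : Type) (M : relStructure L).
Implicit Types f g : Aut M.

Lemma aut_eqP f g : f =1 g -> f = g.
Proof.
case: f g => [f f' fK f'K fr] [g g' gK g'K gr] /= /funext fg.
have fg' : f' = g'.
  by apply/funext => x; rewrite -[x in LHS]g'K -fg fK.
by subst; congr MkAut; exact: Prop_irrelevance.
Qed.

HB.instance Definition _ := gen_eqMixin (Aut M).
HB.instance Definition _ := gen_choiceMixin (Aut M).

Definition aut_one : Aut M :=
  @MkAut _ M id id (fun=> erefl) (fun=> erefl) (fun _ _ _ => iff_refl _).

Definition aut_mul f g : Aut M :=
  @MkAut _ M (f \o g) (aut_inv g \o aut_inv f)
    (can_comp (@aut_funK _ _ f) (@aut_funK _ _ g))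
    (can_comp (@aut_invK _ _ g) (@aut_invK _ _ f))
    (fun l x y => iff_trans (aut_rel f l (g x) (g y)) (aut_rel g l x y)).

Lemma aut_inv_rel f l x y :
  rel_of l (aut_inv f x) (aut_inv f y) <-> rel_of l x y.
Proof. by have := aut_rel f l (aut_inv f x) (aut_inv f y); rewrite !aut_invK; exact: iff_sym. Qed.

Definition aut_opp f : Aut M :=
  @MkAut _ M (aut_inv f) f (@aut_invK _ _ f) (@aut_funK _ _ f)
    (aut_inv_rel f).

Lemma aut_mulA : associative aut_mul. Proof. by move=> f g h; exact: aut_eqP. Qed.
Lemma aut_mul1g : left_id aut_one aut_mul. Proof. by move=> f; exact: aut_eqP. Qed.
Lemma aut_mulg1 : right_id aut_one aut_mul. Proof. by move=> f; exact: aut_eqP. Qed.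
Lemma aut_mulVg : left_inverse aut_one aut_opp aut_mul.
Proof. by move=> f; apply: aut_eqP => x /=; rewrite aut_funK. Qed.
Lemma aut_mulgV : right_inverse aut_one aut_opp aut_mul.
Proof. by move=> f; apply: aut_eqP => x /=; rewrite aut_invK. Qed.

HB.instance Definition _ := isGroup.Build (Aut M)
  aut_mulA aut_mul1g aut_mulg1 aut_mulVg aut_mulgV.
HB.instance Definition _ := isPointed.Build (Aut M) aut_one.

Definition aut_ptws (f : Aut M) : {ptws M -> discrete_topology M} := f.

HB.instance Definition _ :=
  Topological.copy (Aut M) (initial_topology aut_ptws).

Lemma aut_mulE f g x : (f * g)%g x = f (g x). Proof. by []. Qed.
Lemma aut_invE f x : (f^-1)%g x = aut_inv f x. Proof. by []. Qed.

Lemma aut_nbhsP f (A : set (Aut M)) : nbhs f A <->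
  exists s : seq M, forall g, {in s, g =1 f} -> A g.
Proof.
split.
  case=> _ [[B oB <-] /= Bf BA].
  have nB : nbhs (aut_ptws f) B by exact: open_nbhs_nbhs.
  set F := filter_from [set: seq M]
    (fun s => [set g : {ptws M -> discrete_topology M} | {in s, g =1 f}]).
  have FF : Filter F.
    apply: filter_from_filter; first by exists [::].
    move=> s t _ _; exists (s ++ t) => // g /= gst; split=> x xs; apply: gst.
      by rewrite mem_cat xs.
    by rewrite mem_cat xs orbT.
  have : F --> aut_ptws f.
    apply/cvg_sup => x.
    apply/cvg_image.
      by apply/seteqP; split=> // y _; exists (fun=> y).
    rewrite /= => C Cf.
    exists [set g | C (g x)].
      exists [:: x] => // g gx; have gfx : g x = f x by apply: gx; rewrite inE.
      by have : C (f x) := nbhs_singleton Cf; rewrite -gfx.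
    apply/seteqP; split=> [_ [g ? <-]//|y Cy].
    by exists (fun=> y).
  move=> /(_ B nB)[s _ sB]; exists s => g gf; apply: BA => /=.
  exact: sB.
case=> s sA.
apply: filterS sA _; elim: s => [|x s IHs]; first by apply: filterS filterT.
have nx : nbhs f [set g : Aut M | g x = f x].
  pose P := [set y : discrete_topology M | y = f x].
  have nP : nbhs (aut_ptws f x) P by exact: discrete_set1.
  have cx := @proj_continuous M (fun=> discrete_topology M) x (aut_ptws f).
  exact: (@initial_continuous _ _ aut_ptws f _ (cx P nP)).
apply: filterS (filterI nx IHs) => g [gx gs] y.
by rewrite inE => /orP[/eqP->//|]; exact: gs.
Qed.

Lemma aut_mul_continuous : continuous (fun p : Aut M * Aut M => (p.1 * p.2)%g).
Proof.
move=> -[f g] A /aut_nbhsP[s sA].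
have : nbhs (f, g) [set p : Aut M * Aut M |
    {in s, forall x, p.2 x = g x /\ p.1 (g x) = f (g x)}].
  exists ([set f' : Aut M | {in s, forall x, f' (g x) = f (g x)}],
          [set g' : Aut M | {in s, g' =1 g}]) => /=; first split.
  - apply/aut_nbhsP; exists [seq g x | x <- s] => h hf x xs.
    by apply: hf; exact: map_f.
  - by apply/aut_nbhsP; exists s.
  - by move=> -[f' g'] /= [f'P g'P] x xs; split; [exact: g'P|exact: f'P].
apply: filterS => -[f' g'] P; apply: sA => x xs.
by have [g'x f'x] := P x xs; exact: etrans (congr1 f' g'x) f'x.
Qed.

Lemma aut_inv_continuous : continuous (fun f : Aut M => (f^-1)%g).
Proof.
move=> f A /aut_nbhsP[s sA]; apply/aut_nbhsP.
exists [seq aut_inv f x | x <- s] => g gf; apply: sA => x xs.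
rewrite !aut_invE -[x in LHS](aut_invK f) -(gf _ (map_f _ xs)).
by rewrite aut_funK.
Qed.

Lemma aut_second_countable : @second_countable (Aut M).
Proof.
pose b (s : seq (M * M)) := [set g : Aut M | {in s, forall p, g p.1 = p.2}].
exists (range b); first exact: sub_countable (card_image_le _ _) (countableP _).
split.
  move=> _ [s _ <-]; rewrite openE => g gs; apply/aut_nbhsP.
  exists [seq p.1 | p <- s] => h hg p ps.
  by rewrite hg ?gs// map_f.
move=> f A /aut_nbhsP[s sA].
exists (b [seq (x, f x) | x <- s]).
  split; first by exists [seq (x, f x) | x <- s].
  by move=> _ /mapP[x xs ->].
by move=> g gP; apply: sA => x xs; exact: (gP _ (map_f _ xs)).
Qed.

HB.instance Definition _ := isSecondCountableTopGroup.Build (Aut M)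
  aut_mul_continuous aut_inv_continuous aut_second_countable.

End AutGroup.

Section UnitInterval.
Context (R : realType).
Local Notation cmu := (@completed_lebesgue_measure R).
Local Notation lebesgue_measurable :=
  ((wlength (idfun : R -> R))^*%mu.-cara.-measurable).

(* [0, 1] with the trace of the Lebesgue measurable subsets of R and of the
   (complete) Lebesgue measure. *)
Definition unit_interval := {x : R | x \in `[0, 1]}.

HB.instance Definition _ := Choice.on unit_interval.

Lemma unit_interval0 : 0 \in `[0 : R, 1].
Proof. by rewrite in_itv /= lexx ler01. Qed.

HB.instance Definition _ := isPointed.Build unit_interval
  (exist _ 0 unit_interval0 : unit_interval).

Definition unit_interval_measurable : set (set unit_interval) :=
  [set A | lebesgue_measurable (val @` A)].

Lemma range_unit_interval :
  val @` [set: unit_interval] = [set` `[0 : R, 1]].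
Proof.
apply/seteqP; split=> [_ [x _ <-]/=|x /= x01]; first exact: valP.
by exists (exist _ x x01 : unit_interval).
Qed.

Lemma unit_interval_measurable0 : unit_interval_measurable set0.
Proof. by rewrite /unit_interval_measurable /= image_set0. Qed.

Lemma unit_interval_measurableC A :
  unit_interval_measurable A -> unit_interval_measurable (~` A).
Proof.
rewrite /unit_interval_measurable /= => mA.
have -> : val @` (~` A) = [set` `[0 : R, 1]] `\` val @` A.
  rewrite -range_unit_interval; apply/seteqP; split=> [_ [x Ax <-]|_ [[x _ <-] Ax]].
    by split; [exists x|move=> [y Ay /val_inj yx]; apply: Ax; rewrite -yx].
  by exists x => // xA; apply: Ax; exists x.
apply: measurableD => //; apply: sub_caratheodory.
exact: measurable_itv.
Qed.

Lemma unit_interval_measurable_bigcup (F : (set unit_interval)^nat) :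
  (forall i, unit_interval_measurable (F i)) ->
  unit_interval_measurable (\bigcup_i F i).
Proof.
move=> mF; rewrite /unit_interval_measurable /= image_bigcup.
exact: bigcupT_measurable.
Qed.

HB.instance Definition _ := isMeasurable.Build default_measure_display
  unit_interval unit_interval_measurable0 unit_interval_measurableC
  unit_interval_measurable_bigcup.

Definition unit_lebesgue (A : set unit_interval) : \bar R := cmu (val @` A).

Lemma unit_lebesgue0 : unit_lebesgue set0 = 0%E.
Proof. by rewrite /unit_lebesgue image_set0 measure0. Qed.

Lemma unit_lebesgue_ge0 A : (0 <= unit_lebesgue A)%E.
Proof. exact: measure_ge0. Qed.

Lemma unit_lebesgue_sigma_additive : semi_sigma_additive unit_lebesgue.
Proof.
move=> F mF tF mUF; rewrite /unit_lebesgue image_bigcup.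
apply: measure_semi_sigma_additive => //.
- apply/trivIsetP => i j _ _ ij.
  have /trivIsetP/(_ i j Logic.I Logic.I ij) FF := tF.
  rewrite -subset0 => _ [[x Fx <-] [y Fy /val_inj yx]].
  suff : (F i `&` F j) x by rewrite FF.
  by split => //; rewrite -yx.
- exact: bigcupT_measurable.
Qed.

HB.instance Definition _ := isMeasure.Build _ _ _ unit_lebesgue
  unit_lebesgue0 unit_lebesgue_ge0 unit_lebesgue_sigma_additive.

End UnitInterval.

Section MeasurableMaps.
Context d (T : measurableType d) (G : scTopGroupType).

Definition borel : Type := g_sigma_algebraType (@open G).
HB.instance Definition _ := Measurable.on borel.
Implicit Types f g : {mfun T >-> borel}.

Lemma borel_open (f : {mfun T >-> borel}) (U : set G) :
  open U -> measurable (f @^-1` U).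
Proof. by move=> oU; apply: measurable_funPTI; exact: sub_sigma_algebra. Qed.

Lemma borel_measurable_fun (h : T -> borel) :
  (forall U : set G, open U -> measurable (h @^-1` U)) ->
  measurable_fun setT h.
Proof.
move=> hU; apply: (@measurability _ _ T borel setT h (@open G)) => //.
by move=> _ [U oU <-]; rewrite setTI; exact: hU.
Qed.

Definition mf_one_fun : T -> borel := fun=> (1%g : G).
Definition mf_mul_fun f g : T -> borel := fun x => ((f x : G) * (g x : G))%g.
Definition mf_inv_fun f : T -> borel := fun x => ((f x : G)^-1)%g.

Lemma mf_one_measurable : measurable_fun setT mf_one_fun.
Proof. exact: measurable_cst. Qed.

Lemma mf_inv_measurable f : measurable_fun setT (mf_inv_fun f).
Proof.
apply: borel_measurable_fun => U oU.
apply: (borel_open f (U := (fun y : G => (y^-1)%g) @^-1` U)).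
by apply: open_comp => // y _; exact: invg_continuous.
Qed.

Lemma mf_mul_measurable f g : measurable_fun setT (mf_mul_fun f g).
Proof.
apply: borel_measurable_fun => U oU.
have [B cB [oB Bnbhs]] := @second_countableG G.
pose D := [set p : set G * set G | [/\ B p.1, B p.2 &
  forall a b, p.1 a -> p.2 b -> U (a * b)%g]].
have cD : countable D.
  apply: (sub_countable _ (countableX cB cB)).
  by apply: subset_card_le => -[V W] [].
have -> : mf_mul_fun f g @^-1` U =
    \bigcup_(p in D) (f @^-1` p.1 `&` g @^-1` p.2).
  apply/seteqP; split=> [x Ux|x [[V W] [_ _ VW] [fx gx]]]; last exact: VW.
  have : nbhs ((f x : G) * (g x : G))%g U by exact: open_nbhs_nbhs.
  move=> /(@mulg_continuous G (f x, g x))[[V W] /= [/Bnbhs[V' [BV' V'x] V'V]]].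
  move=> /Bnbhs[W' [BW' W'x] W'W] VWU.
  exists (V', W'); last by [].
  split => // a b /V'V Va /W'W Wb.
  exact: (VWU (a, b)).
rewrite bigcup_set_type; apply: countable_bigcupT_measurable.
  by rewrite (eq_countable (card_setT D)).
move=> [[V W] /set_mem[BV BW _]] /=; apply: measurableI; apply: borel_open; exact: oB.
Qed.

HB.instance Definition _ := isMeasurableFun.Build _ _ _ _
  mf_one_fun mf_one_measurable.
HB.instance Definition _ f g := isMeasurableFun.Build _ _ _ _
  (mf_mul_fun f g) (mf_mul_measurable f g).
HB.instance Definition _ f := isMeasurableFun.Build _ _ _ _
  (mf_inv_fun f) (mf_inv_measurable f).

Definition mf_one : {mfun T >-> borel} := mf_one_fun.
Definition mf_mul f g : {mfun T >-> borel} := mf_mul_fun f g.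
Definition mf_inv f : {mfun T >-> borel} := mf_inv_fun f.

End MeasurableMaps.

Section L0.
Context d (T : measurableType d) (R : realType).
Variables (mu : {measure set T -> \bar R}) (G : scTopGroupType).
Local Open Scope quotient_scope.

(* The library's quotient of the measurable maps by equality mu-a.e. *)
Definition L0 : Type := {mfun_ mu, T >-> borel G}.

HB.instance Definition _ := Choice.on L0.
HB.instance Definition _ := EqQuotient.on L0.

Definition L0_fun (f : L0) : T -> G := (repr f : {mfun T >-> borel G}).

Definition L0_one : L0 := \pi_L0 (mf_one T G).
Definition L0_mul (f g : L0) : L0 := \pi_L0 (mf_mul (repr f) (repr g)).
Definition L0_inv (f : L0) : L0 := \pi_L0 (mf_inv (repr f)).

Lemma L0_fun_pi (h : {mfun T >-> borel G}) :
  \forall x \ae mu, L0_fun (\pi_L0 h) x = h x.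
Proof.
have /eqmodP/asboolP := reprK (\pi_L0 h).
by apply: filterS => x /(_ Logic.I).
Qed.

Lemma L0_eq_ae (f g : L0) : (\forall x \ae mu, L0_fun f x = L0_fun g x) -> f = g.
Proof.
move=> fg; rewrite -[f]reprK -[g]reprK; apply/eqmodP/asboolP.
by apply: filterS fg => x.
Qed.

Lemma L0_funM (f g : L0) :
  \forall x \ae mu, L0_fun (L0_mul f g) x = (L0_fun f x * L0_fun g x)%g.
Proof. exact: L0_fun_pi. Qed.

Lemma L0_fun1 : \forall x \ae mu, L0_fun L0_one x = 1%g.
Proof. exact: L0_fun_pi. Qed.

Lemma L0_funV (f : L0) :
  \forall x \ae mu, L0_fun (L0_inv f) x = (L0_fun f x)^-1%g.
Proof. exact: L0_fun_pi. Qed.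

Lemma L0_mulA : associative L0_mul.
Proof.
move=> f g h; apply: L0_eq_ae.
have fgh := L0_funM f (L0_mul g h); have gh := L0_funM g h.
have fgh' := L0_funM (L0_mul f g) h; have fg := L0_funM f g.
by near=> x; rewrite (near fgh) // (near gh) // (near fgh') // (near fg) // mulgA.
Unshelve. all: by end_near. Qed.

Lemma L0_mul1g : left_id L0_one L0_mul.
Proof.
move=> f; apply: L0_eq_ae; have f1 := L0_funM L0_one f; have := L0_fun1.
by move: f1; apply: filterS2 => x -> ->; rewrite mul1g.
Qed.

Lemma L0_mulg1 : right_id L0_one L0_mul.
Proof.
move=> f; apply: L0_eq_ae; have f1 := L0_funM f L0_one; have := L0_fun1.
by move: f1; apply: filterS2 => x -> ->; rewrite mulg1.
Qed.

Lemma L0_mulVg : left_inverse L0_one L0_inv L0_mul.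
Proof.
move=> f; apply: L0_eq_ae; move: (L0_funM (L0_inv f) f) (L0_funV f) L0_fun1.
by apply: filterS3 => x -> -> ->; rewrite mulVg.
Qed.

Lemma L0_mulgV : right_inverse L0_one L0_inv L0_mul.
Proof.
move=> f; apply: L0_eq_ae; move: (L0_funM f (L0_inv f)) (L0_funV f) L0_fun1.
by apply: filterS3 => x -> -> ->; rewrite mulgV.
Qed.

HB.instance Definition _ := isGroup.Build L0
  L0_mulA L0_mul1g L0_mulg1 L0_mulVg L0_mulgV.

(* The choice of the representative of f does not matter. *)
Definition L0_ball (V : set G) (e : R) : set L0 :=
  [set f | (mu [set x | ~ V (L0_fun f x)] < e%:E)%E].

Lemma L0_fun_measurable (f : L0) (V : set G) :
  open V -> measurable [set x | ~ V (L0_fun f x)].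
Proof.
by move=> oV; exact: measurableC (borel_open (repr f : {mfun T >-> borel G}) oV).
Qed.

Lemma L0_ball1 (V : set G) (e : R) : V 1%g -> open V -> 0 < e -> L0_ball V e 1%g.
Proof.
move=> V1 oV e0; rewrite /L0_ball /=.
have [N [mN N0 NV]] := L0_fun1.
apply: (@le_lt_trans _ _ 0%E); last by rewrite lte_fin.
rewrite -N0; apply: le_measure; rewrite ?inE//; first exact: L0_fun_measurable.
by move=> x Vx; apply: NV => /= h1; apply: Vx; rewrite h1.
Qed.

Lemma L0_ballM (V W : set G) (e e' : R) (f g : L0) : open V -> open W ->
  (forall a b, V a -> V b -> W (a * b)%g) ->
  L0_ball V e f -> L0_ball V e' g -> L0_ball W (e + e') (f * g)%g.
Proof.
move=> oV oW VW; rewrite /L0_ball /= => fV gV.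
have [N [mN N0 NV]] := L0_funM f g.
rewrite EFinD; apply: le_lt_trans (lteD fV gV).
have mf := L0_fun_measurable f oV; have mg := L0_fun_measurable g oV.
rewrite -[leRHS]adde0 -N0.
apply: (le_trans _ (leeD2r _ (measureU2 mu mf mg))).
apply: (le_trans _ (measureU2 mu (measurableU _ _ mf mg) mN)).
apply: le_measure; rewrite ?inE.
- exact: L0_fun_measurable.
- by apply: measurableU => //; exact: measurableU.
move=> x Wx; have [fgx|fgx] := pselect (L0_fun (L0_mul f g) x = (L0_fun f x * L0_fun g x)%g); last first.
  by right; apply: NV.
left; have [Vf|] := pselect (V (L0_fun f x)); last by left.
have [Vg|] := pselect (V (L0_fun g x)); last by right.
by exfalso; apply: Wx; rewrite [X in W X]fgx; exact: VW.
Qed.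

Lemma L0_ballS (V W : set G) (e e' : R) : open V -> open W -> V `<=` W ->
  e <= e' -> L0_ball V e `<=` L0_ball W e'.
Proof.
move=> oV oW VW ee' f; rewrite /L0_ball /= => fV.
apply: (@lt_le_trans _ _ e%:E); last by rewrite lee_fin.
apply: le_lt_trans fV; apply: le_measure; rewrite ?inE.
- exact: L0_fun_measurable.
- exact: L0_fun_measurable.
by move=> x Wx Vx; apply: Wx; exact: VW.
Qed.

(* Left translates of the basic neighbourhoods of the identity. *)
Definition L0_nbhs (f : L0) : set_system L0 :=
  filter_from [set p : set G * R | open_nbhs 1%g p.1 /\ 0 < p.2]
    (fun p => [set g | L0_ball p.1 p.2 (f^-1 * g)%g]).

HB.instance Definition _ := hasNbhs.Build L0 L0_nbhs.

Lemma L0_nbhs_filter (f : L0) : ProperFilter (nbhs f).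
Proof.
apply: filter_from_proper; last first.
  by move=> [V e] /= [[oV V1] e0]; exists f => /=; rewrite mulVg; exact: L0_ball1.
apply: filter_from_filter.
  by exists (setT, 1) => /=; split => //; exact: open_nbhsT.
move=> [V e] [W e'] /= [nV e0] [nW e'0].
exists (V `&` W, Num.min e e') => /=.
  by split; [exact: open_nbhsI|rewrite lt_min e0].
have oVW := openI nV.1 nW.1.
move=> g /= fg; split.
- by apply: L0_ballS oVW nV.1 _ _ _ fg; [exact: subIsetl|rewrite ge_min lexx].
- by apply: L0_ballS oVW nW.1 _ _ _ fg; [exact: subIsetr|rewrite ge_min lexx orbT].
Qed.

Lemma L0_nbhs_singleton (f : L0) (A : set L0) : nbhs f A -> A f.
Proof.
by move=> [[V e] /= [[oV V1] e0]]; apply; rewrite /= mulVg; exact: L0_ball1.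
Qed.

Lemma L0_nbhs_nbhs (f : L0) (A : set L0) : nbhs f A -> nbhs f (nbhs^~ A).
Proof.
move=> [[V e] /= [nV e0] VA].
have : nbhs ((1 : G) * 1)%g V by rewrite mulg1; exact: open_nbhs_nbhs.
move=> /(@mulg_continuous G (1%g, 1%g))[[W W'] /= []].
rewrite !nbhsE => -[U nU UW] [U' nU' UW'] WV.
pose Z := U `&` U'.
have nZ : open_nbhs 1%g Z by exact: open_nbhsI.
have ZV a b : Z a -> Z b -> V (a * b)%g.
  by move=> [/UW Wa _] [_ /UW' Wb]; exact: (WV (a, b)).
have e20 : 0 < e / 2 by rewrite divr_gt0.
exists (Z, e / 2) => //= g /= fg; exists (Z, e / 2) => //= h /= gh.
apply: VA => /=.
have -> : (f^-1 * h = (f^-1 * g) * (g^-1 * h))%g by rewrite -mulgA mulVKg.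
by rewrite [e]splitr; exact: L0_ballM nZ.1 nV.1 ZV fg gh.
Qed.

HB.instance Definition _ := Nbhs_isNbhsTopological.Build L0
  L0_nbhs_filter L0_nbhs_singleton L0_nbhs_nbhs.

End L0.

Section TopologicalSimilarity.
Context (H : groupTopologicalType).

Definition is_subgroup : set (set H) :=
  [set S | [/\ S 1%g, forall x y, S x -> S y -> S (x * y)%g &
    forall x, S x -> S x^-1%g]].

Definition gen2 (f : H * H) : set H := smallest is_subgroup [set f.1; f.2].

(* phi and psi are total maps whose values outside A and B do not matter;
   continuity within A is continuity for the subspace topology of A. *)
Definition bicontinuous_iso (A B : set H) (phi : H -> H) : Prop :=
  [/\ set_bij A B phi,
      forall x y, A x -> A y -> phi (x * y)%g = (phi x * phi y)%g,
      {within A, continuous phi} &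
      exists2 psi : H -> H, {in A, cancel phi psi} & {within B, continuous psi}].

Definition similarity_class2 (f : H * H) : set (H * H) :=
  [set g | exists phi : H -> H,
    [/\ bicontinuous_iso (gen2 f) (gen2 g) phi, phi f.1 = g.1 & phi f.2 = g.2]].

End TopologicalSimilarity.

Definition nowhere_dense (T : topologicalType) (A : set T) : Prop :=
  (closure A)° = set0.

Definition meager (T : topologicalType) (A : set T) : Prop :=
  exists2 F : (set T)^nat, forall n, nowhere_dense (F n) & A `<=` \bigcup_n F n.

(* Main.v *)
From HB Require Import structures.
Require Import Defs.
From mathcomp Require Import all_boot all_order all_algebra.
From mathcomp Require Import all_classical all_reals all_analysis.
From mathcomp Require Import ring lra.

Set Implicit Arguments.
Unset Strict Implicit.
Unset Printing Implicit Defensive.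

Import Order.TTheory GRing.Theory Num.Theory.
Import numFieldNormedType.Exports.

(** Write H for L_0(Aut M), whose elements are random automorphisms of M.  If the
    pairs g and h in H lie in one similarity class, they induce the same group topology on the free
    group of words in two letters ([similar_eval]).  So it is enough to see that,
    for a generic g and for h in any open set, some word is close to 1 at g and
    far from 1 at h.  A neighbourhood in H only constrains a random pair on a
    finite set A and up to small measure, and up to small measure the pair takes
    finitely many values on A; thus everything comes down to finitely many pairs
    of automorphisms, prescribed on a finite set.  The combinatorial core is
    [common_word]: for two finite lists of pairs and a finite set A there is one
    word w such that every pair of the first list can be changed off A so that w
    fixes A pointwise, and every pair of the second list can be changed off A so
    that w moves a given point moved by the first member of the pair.  The sets
    [blind], [dominated] and [motionless] translate this into category.

    The word has the form w = u^-1 t u with t a letter.  The word u has to carry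
    A, for every pair of both lists, to a position over which nothing is known
    except the common fixed points C of the pair; then t can be defined there at
    will, as the identity or as a moving map.  A point whose orbit is finite under
    a partial order automorphism is fixed, and this is what makes such a u exist.
    - Order ([all_free]).  Between two neighbouring common fixed points some
      letter pushes each given point up ([pushing_letter]), so one point can be
      driven above all known points of its interval ([climb_top]).  Repeating one
      letter then outruns everything ([chain_step]), and the rest of A
      follows.
    - Metric ([apart_increase]).  New values are chosen at the largest possible
      distances, truncated at a bound D.  A long power of one letter leaves only
      the points fixed by that letter close to the images of A; a long power of
      the other letter then leaves only C.  Each round gains a fixed amount, so
      distances to all known points end up as large as C and D permit.
    Both properties survive any reduced continuation of u ([ready_runs]), so
    the pairs of the two lists can be treated one after the other.

    The rational order and the ordered rational Urysohn space are handled
    together as instances of [homogeneous_action]. *)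

Local Open Scope ring_scope.
Local Open Scope order_scope.

(** * Words in two generators *)

Definition letter : Type := bool * bool.
Definition word : Type := seq letter.
Definition inv_letter (s : letter) : letter := (s.1, ~~ s.2).

Section Words.
Context (G : groupType).
Implicit Types (g : bool -> G) (s : letter) (w : word).

Definition eval_letter g s : G := if s.2 then g s.1 else (g s.1)^-1%g.
(** The head of a word is the letter that acts last. *)
Definition word_eval g w : G := foldr (fun s h => eval_letter g s * h)%g 1%g w.

Lemma eval_cat g w w' : word_eval g (w ++ w') = (word_eval g w * word_eval g w')%g.
Proof. by elim: w => [|s w IH] /=; rewrite ?mul1g// IH mulgA. Qed.

Definition inv_word w : word := rev (map inv_letter w).

Lemma eval_inv_letter g s : eval_letter g (inv_letter s) = (eval_letter g s)^-1%g.
Proof. by case: s => i [] /=; rewrite /eval_letter //= invgK. Qed.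

Lemma eval_inv_word g w : word_eval g (inv_word w) = (word_eval g w)^-1%g.
Proof.
elim: w => [|s w IH] /=; first by rewrite invg1.
rewrite /inv_word /= rev_cons -cats1 eval_cat [word_eval g (rev _)]IH /= mulg1.
by rewrite eval_inv_letter invgM.
Qed.

End Words.

Lemma inv_letterK : involutive inv_letter.
Proof. by case=> i e; rewrite /inv_letter /= negbK. Qed.

Definition reduced w : bool := sorted (fun s t : letter => s != inv_letter t) w.

Lemma reduced_cons t r W u : reduced (W ++ r :: u) -> t != inv_letter (head r W) ->
  reduced (t :: W ++ r :: u).
Proof. by rewrite /reduced /=; case: W => [|p W] /= -> ->. Qed.

(** * Homogeneous actions on ordered metric spaces *)

(** Common setting for the two structures.  The parameter [adm] selects the
    distances D up to which one-point extensions exist: the rational order is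
    taken with the zero distance and D = 0, the Urysohn space with all D > 0. *)
Record homogeneous_action (disp : Order.disp_t) (X : orderType disp)
    (G : groupType) (act : G -> X -> X) (d : X -> X -> rat)
    (adm : rat -> Prop) : Prop := HomogeneousAction {
  act_one : forall x, act 1%g x = x ;
  act_mul : forall g h x, act (g * h)%g x = act g (act h x) ;
  act_lt : forall g x y, (act g x < act g y) = (x < y) ;
  act_dist : forall g x y, d (act g x) (act g y) = d x y ;
  dist_refl : forall x, d x x = 0 ;
  dist_sym : forall x y, d x y = d y x ;
  dist_tri : forall x y z, d x z <= d x y + d y z ;
  adm_ge0 : forall D, adm D -> 0 <= D ;
  adm_bound : forall S : seq X, exists2 D, adm D & {in S &, forall x y, d x y <= D} ;
  adm_dist : forall D, adm D -> 0 < D -> forall x y, x != y -> 0 < d x y ;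
  act_homogeneous : forall (A : seq X) (f : X -> X),
    {in A &, forall x y, (f x < f y) = (x < y)} ->
    {in A &, forall x y, d (f x) (f y) = d x y} ->
    exists g, {in A, act g =1 f} ;
  one_point_extension : forall D (Y : seq X) (U : pred X) (f : X -> rat), adm D ->
    {in Y &, forall x y, x <= y -> U x -> U y} ->
    {in Y, forall y, f y <= D /\ (0 < D -> 0 < f y)} ->
    {in Y &, forall x y, f x <= f y + d x y /\ d x y <= f x + f y} ->
    exists z, {in Y, forall y, [/\ d z y = f y, (z < y) = U y & (y < z) = ~~ U y]} }.

Lemma count_lt (T : eqType) (p q : pred T) (S : seq T) y :
  {in S, forall x, p x -> q x} -> y \in S -> q y -> ~~ p y -> (count p S < count q S)%N.
Proof.
elim: S => // x S IH pq; rewrite inE /= => /orP[/eqP <-|yS] qy py.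
  rewrite qy (negPf py) add0n add1n ltnS (eq_in_count (a2 := predI p q)).
    by apply: sub_count => z /andP[].
  by move=> z zS /=; have := pq z; rewrite inE zS orbT; case: (p z) => // ->.
rewrite -addnS leq_add//; last by apply: IH => // z zS; apply: pq; rewrite inE zS orbT.
by have := pq x (mem_head _ _); case: (p x) => // ->.
Qed.

Section Systems.
Context (disp : Order.disp_t) (X : orderType disp) (G : groupType).
Context (act : G -> X -> X) (d : X -> X -> rat) (adm : rat -> Prop).
Context (actP : homogeneous_action act d adm).
Implicit Types (x y z a b c e : X) (h : G) (g : bool -> G) (s : letter).
Implicit Types (w v u : word) (E : bool -> seq X) (A B Y : seq X).

Let act1 := act_one actP. Let actM := act_mul actP. Let ltact := act_lt actP.
Let dact := act_dist actP. Let dxx := dist_refl actP. Let dC := dist_sym actP.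
Let dtri := dist_tri actP.

Lemma dist_ge0 x y : 0 <= d x y.
Proof. by have := dtri x y x; rewrite dxx (dC y x); lra. Qed.

Lemma actK h : cancel (act h) (act h^-1%g).
Proof. by move=> x; rewrite -actM mulVg act1. Qed.

Lemma act_inj h : injective (act h).
Proof. exact: can_inj (actK h). Qed.

Lemma act_le h x y : (act h x <= act h y) = (x <= y).
Proof. by rewrite !leNgt ltact. Qed.

Definition diam_le D Y := {in Y &, forall x y, d x y <= D}.

(** The new value at [b] lies above all points of [Y] that the values on [E] leave
    possible, at the distances of the free amalgam over [E] truncated at [D]. *)
Lemma push_up1 D h (E : seq X) b Y : adm D -> b \notin E -> {in E, forall e, d b e <= D} ->
    diam_le D (Y ++ map (act h) E) ->
  exists h', [/\ {in E, act h' =1 act h},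
    {in Y, forall y, {in E, forall e, b <= e -> y < act h e} -> y < act h' b},
    {in Y, forall y, D <= d (act h' b) y \/
       exists2 e, e \in E & d b e + d (act h e) y <= d (act h' b) y} &
    {in Y, forall y, d (act h' b) y <= D}].
Proof.
move=> aD bE bD YD.
pose f y := foldr (fun e m => Num.min m (d b e + d (act h e) y)) D E.
have fD y : f y <= D.
  by rewrite /f; elim: (E) => //= e l IH; rewrite ge_min IH.
have fE y e : e \in E -> f y <= d b e + d (act h e) y.
  rewrite /f; elim: (E) => //= e' l IH; rewrite inE => /orP[/eqP->|/IH el].
    by rewrite ge_min lexx orbT.
  by rewrite ge_min el.
have fex y : f y = D \/ exists2 e, e \in E & f y = d b e + d (act h e) y.
  rewrite /f; elim: (E) => /= [|e l [->|[e' el ->]]]; first by left.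
    case: leP => _; [by left|right; exists e => //; exact: mem_head].
  case: leP => _; right; [exists e' => //|exists e => //; exact: mem_head].
  by rewrite inE el orbT.
set Y' := Y ++ map (act h) E in YD *.
have YY y : y \in Y -> y \in Y' by rewrite mem_cat => ->.
have hE e : e \in E -> act h e \in Y'.
  by move=> eE; rewrite mem_cat map_f ?orbT.
(* [U] is the set of points that the new value must stay below. *)
pose U y := has (fun e => (b < e) && (act h e <= y)) E.
have [z zP] : exists z, {in Y', forall y, [/\ d z y = f y, (z < y) = U y & (y < z) = ~~ U y]}.
  apply: (one_point_extension actP aD).
  - move=> x y _ _ xy /hasP[e eE /andP[be hex]]; apply/hasP; exists e => //.
    by rewrite be (le_trans hex).
  - move=> y yY; split=> // D0; case: (fex y) => [->//|[e eE ->]].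
    have be : b != e by apply: contraNneq bE => ->.
    by have := adm_dist actP aD D0 be; have := dist_ge0 (act h e) y; lra.
  - move=> x y xY yY; split.
      case: (fex y) => [->|[e eE ->]]; first by have := fD x; have := dist_ge0 x y; lra.
      have := fE x e eE; have := dtri (act h e) y x; rewrite (dC y x); lra.
    have xyD := YD _ _ xY yY.
    have pos t : 0 <= f t.
      case: (fex t) => [->|[e _ ->]]; first exact: (adm_ge0 actP aD).
      by rewrite addr_ge0 ?dist_ge0.
    case: (fex x) => [->|[e eE ->]]; first by have := pos y; lra.
    case: (fex y) => [->|[e' eE' ->]].
      by have := dist_ge0 b e; have := dist_ge0 (act h e) x; lra.
    have := dtri x (act h e) y; have := dtri (act h e) (act h e') y.
    rewrite dact (dC x (act h e)); have := dtri e b e'; rewrite (dC e b); lra.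
have [h' h'P] : exists h', {in b :: E, act h' =1 fun x => if x == b then z else act h x}.
  have nb e : e \in E -> (e == b) = false.
    by move=> eE; apply: contraNF bE => /eqP <-.
  have Ulow e : e \in E -> U (act h e) = (b < e).
    move=> eE; apply/hasP/idP => [[e' e'E /andP[be']]|be].
      by rewrite act_le; exact: lt_le_trans.
    by exists e => //; rewrite be lexx.
  apply: (act_homogeneous actP).
    move=> x y; rewrite !inE.
    case/orP=> [/eqP->|xE]; case/orP=> [/eqP->|yE]; rewrite ?eqxx ?nb ?ltxx//.
    - by have [_ -> _] := zP _ (hE _ yE); exact: Ulow.
    - have [_ _ ->] := zP _ (hE _ xE); rewrite Ulow // -leNgt le_eqVlt.
      by rewrite nb.
  have fe e : e \in E -> f (act h e) = d b e.
    move=> eE; apply/eqP; rewrite eq_le; apply/andP; split.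
      by have := fE (act h e) e eE; rewrite dxx addr0.
    case: (fex (act h e)) => [->|[e' e'E ->]]; first exact: bD.
    by rewrite dact.
  move=> x y; rewrite !inE.
  case/orP=> [/eqP->|xE]; case/orP=> [/eqP->|yE]; rewrite ?eqxx ?nb ?dxx//.
  - by have [-> _ _] := zP _ (hE _ yE); exact: fe.
  - by rewrite dC; have [-> _ _] := zP _ (hE _ xE); rewrite fe// dC.
have h'b : act h' b = z by rewrite h'P ?mem_head// eqxx.
exists h'; rewrite h'b; split.
- move=> e eE; rewrite h'P ?inE ?eE ?orbT//.
  by case: eqP => // eb; rewrite -eb eE in bE.
- move=> y yY yE; have [_ _ ->] := zP y (YY y yY).
  apply/hasP => -[e eE /andP[be hey]].
  by have := yE e eE (ltW be); rewrite ltNge hey.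
- move=> y yY; have [-> _ _] := zP y (YY y yY).
  by case: (fex y) => [->|[e eE ->]]; [left|right; exists e].
- by move=> y yY; have [-> _ _] := zP y (YY y yY).
Qed.

(** The points of [B] are treated one at a time; a lower bound through a point of
    [B] that has already been treated refers back to [E] by the triangle
    inequality. *)
Lemma push_up D h (E : seq X) B Y : adm D -> {subset B <= Y} -> {subset E <= Y} ->
    diam_le D (Y ++ map (act h) E) ->
  exists h', [/\ {in E, act h' =1 act h},
    {in B & Y, forall b y, {in E, forall e, b <= e -> y < act h e} -> y < act h' b},
    {in B & Y, forall b y, D <= d (act h' b) y \/
       exists2 e, e \in E & d b e + d (act h e) y <= d (act h' b) y} &
    {in B & Y, forall b y, d (act h' b) y <= D}].
Proof.
move=> aD; elim: B h E => [|b B IH] h E BY EY YD.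
  by exists h; split.
have bY : b \in Y by apply: BY; exact: mem_head.
have [h1 [h1E o1 m1 b1]] : exists h1, [/\ {in E, act h1 =1 act h},
    {in Y, forall y, {in E, forall e, b <= e -> y < act h e} -> y < act h1 b},
    {in Y, forall y, D <= d (act h1 b) y \/
       exists2 e, e \in E & d b e + d (act h e) y <= d (act h1 b) y} &
    {in Y, forall y, d (act h1 b) y <= D}].
  have [bE|bE] := boolP (b \in E).
    exists h; split=> // [y yY /(_ b bE (lexx b))//|y yY|y yY].
      by right; exists b => //; rewrite dxx add0r.
    by apply: YD; rewrite mem_cat ?map_f ?yY ?orbT.
  have bD : {in E, forall e, d b e <= D}.
    by move=> e eE; apply: YD; rewrite mem_cat; [rewrite bY|rewrite EY].
  have [h1 [h1E o1 m1 b1]] := push_up1 aD bE bD YD.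
  by exists h1.
have [|||h2 [h2E o2 m2 b2]] := IH h1 (b :: E).
- by move=> x xB; apply: BY; rewrite inE xB orbT.
- by move=> x; rewrite inE => /orP[/eqP->//|/EY].
- have imE e : e \in E -> act h1 e \in map (act h) E.
    by move=> eE; rewrite h1E// map_f.
  have YD1 x y : x \in Y ++ map (act h) E -> y \in Y -> d x y <= D.
    by move=> xY yY; apply: YD => //; rewrite mem_cat yY.
  have key x : x \in Y ++ map (act h) E -> d (act h1 b) x <= D.
    rewrite mem_cat => /orP[xY|/mapP[e eE ->]]; first exact: b1.
    by rewrite -h1E// dact; apply: YD1; rewrite ?mem_cat ?bY// EY.
  have cover x : x \in Y ++ map (act h1) (b :: E) ->
      x = act h1 b \/ x \in Y ++ map (act h) E.
    rewrite mem_cat /= inE => /or3P[xY|/eqP->|/mapP[e eE ->]].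
    - by right; rewrite mem_cat xY.
    - by left.
    - by right; rewrite mem_cat imE ?orbT.
  move=> x y /cover[->|xY] /cover[->|yY].
  + by rewrite dxx; exact: (adm_ge0 actP).
  + exact: key.
  + by rewrite dC; exact: key.
  + exact: YD.
have h2b : act h2 b = act h1 b by rewrite h2E ?mem_head.
exists h2; split.
- by move=> e eE; rewrite h2E ?inE ?eE ?orbT// h1E.
- move=> x y; rewrite inE => /orP[/eqP->|xB] yY yE; first by rewrite h2b; exact: o1.
  apply: o2 => // e; rewrite inE => /orP[/eqP->|eE] xe.
    by apply: o1 => // e' e'E be'; apply: yE => //; exact: le_trans be'.
  by rewrite h1E//; exact: yE.
- move=> x y; rewrite inE => /orP[/eqP->|xB] yY; first by rewrite h2b; exact: m1.
  case: (m2 x y xB yY) => [|[e]]; first by left.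
  rewrite inE => /orP[/eqP->|eE] le; last by right; exists e; rewrite // -h1E.
  case: (m1 y yY) => [Dle|[e' e'E le']].
    by left; have := dist_ge0 x b; lra.
  by right; exists e' => //; have := dtri x b e'; lra.
- move=> x y; rewrite inE => /orP[/eqP->|xB] yY; first by rewrite h2b; exact: b1.
  exact: b2.
Qed.

(** * Protected edges *)

Definition move g s x := act (eval_letter g s) x.
Definition run g w x := act (word_eval g w) x.

Lemma run_cons g s w x : run g (s :: w) x = move g s (run g w x).
Proof. by rewrite /run /= actM. Qed.

Lemma run_nil g x : run g [::] x = x.
Proof. exact: act1. Qed.

Lemma run_cat g w v x : run g (w ++ v) x = run g w (run g v x).
Proof. by rewrite /run eval_cat actM. Qed.

Lemma lt_move g s x y : (move g s x < move g s y) = (x < y).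
Proof. exact: ltact. Qed.

Lemma le_move g s x y : (move g s x <= move g s y) = (x <= y).
Proof. exact: act_le. Qed.

Lemma move_inj g s : injective (move g s).
Proof. exact: act_inj. Qed.

Lemma le_run g w x y : (run g w x <= run g w y) = (x <= y).
Proof. exact: act_le. Qed.

Lemma moveK g s : cancel (move g s) (move g (inv_letter s)).
Proof. by move=> x; rewrite /move eval_inv_letter actK. Qed.

Lemma moveVK g s : cancel (move g (inv_letter s)) (move g s).
Proof. by move=> x; rewrite -{1}(inv_letterK s) moveK. Qed.

(** An edge from x to its image under generator i is recorded by its source x, in
    [E i]; [edge g s x] is the source of the edge along which [s] moves x. *)
Definition edge g s x := if s.2 then x else move g s x.
Lemma edge_inj g s : injective (edge g s).
Proof. by rewrite /edge => x y; case: ifP => // _; exact: move_inj. Qed.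

Definition src g E s x : bool := edge g s x \in E s.1.

Lemma edge_move g s x : edge g (inv_letter s) (move g s x) = edge g s x.
Proof. by have := moveK g s x; case: s => i [] /= K; rewrite /edge /= ?K. Qed.

Lemma src_move g E s x : src g E (inv_letter s) (move g s x) = src g E s x.
Proof. by rewrite /src edge_move. Qed.

Definition agree E g g' := forall i, {in E i, act (g' i) =1 act (g i)}.
Definition sub_sources E E' := forall i, {subset E i <= E' i}.

Lemma agree_trans E E' g g' g'' : agree E g g' -> sub_sources E E' -> agree E' g' g'' ->
  agree E g g''.
Proof. by move=> gg' EE' gg'' i x xE; rewrite gg'' ?gg'// EE'. Qed.

Lemma sub_refl E : sub_sources E E. Proof. by move=> i x. Qed.

Lemma sub_trans E E' E'' : sub_sources E E' -> sub_sources E' E'' -> sub_sources E E''.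
Proof. by move=> EE' EE'' i x /EE' /EE''. Qed.

Lemma agree_sym E g g' : agree E g g' -> agree E g' g.
Proof. by move=> gg' i x xE; rewrite gg'. Qed.

Lemma agree_move E g g' s x : agree E g g' -> src g E s x -> move g' s x = move g s x.
Proof.
case: s => i [] gg'; rewrite /src /edge /= => xE; first exact: gg'.
have e : act (g' i) _ = x := etrans (gg' i _ xE) (moveVK g (i, true) x).
by rewrite -{1}e; exact: (moveK g' (i, true)).
Qed.

Lemma agree_srcW E g g' s x : agree E g g' -> src g E s x -> src g' E s x.
Proof.
move=> gg' xE; have e := agree_move gg' xE; move: xE.
by rewrite /src /edge; case: ifP => // _; rewrite e.
Qed.

Lemma agree_src E g g' s x : agree E g g' -> src g' E s x = src g E s x.
Proof.
by move=> gg'; apply/idP/idP; apply: agree_srcW => //; exact: agree_sym.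
Qed.

Lemma src_sub E E' g s x : sub_sources E E' -> src g E s x -> src g E' s x.
Proof. by move=> EE'; exact: EE'. Qed.

Definition vertices g E :=
  E true ++ map (act (g true)) (E true) ++ E false ++ map (act (g false)) (E false).

Lemma verticesP g E x : reflect (exists s, src g E s x) (x \in vertices g E).
Proof.
have mapE i : (x \in map (act (g i)) (E i)) = src g E (i, false) x.
  rewrite /src /edge /=; apply/mapP/idP => [[e eE ->]|xE].
    by have -> : move g (i, false) (act (g i) e) = e := moveK g (i, true) e.
  by exists (move g (i, false) x) => //; rewrite -[LHS](moveVK g (i, true)).
rewrite !mem_cat !mapE; apply: (iffP idP) => [|[[[] []]]].
  case/or4P=> H; [exists (true, true)|exists (true, false)|exists (false, true)|
    exists (false, false)]; exact: H.
- by rewrite /src /edge /= => ->.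
- by move=> ->; rewrite orbT.
- by rewrite /src /edge /= => ->; rewrite !orbT.
- by move=> ->; rewrite !orbT.
Qed.

Lemma src_vertices g E s x : src g E s x -> x \in vertices g E.
Proof. by move=> sx; apply/verticesP; exists s. Qed.

Lemma move_vertices g E s x : src g E s x -> move g s x \in vertices g E.
Proof. by rewrite -src_move => /src_vertices. Qed.

Lemma agree_vertices E g g' x : agree E g g' -> (x \in vertices g' E) = (x \in vertices g E).
Proof.
move=> gg'; apply/verticesP/verticesP => -[s sx]; exists s; first by rewrite -(agree_src _ _ gg').
by rewrite (agree_src _ _ gg').
Qed.

Lemma sub_vertices E E' g : sub_sources E E' -> {subset vertices g E <= vertices g E'}.
Proof. by move=> EE' x /verticesP[s /(src_sub EE') ?]; apply/verticesP; exists s. Qed.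

Fixpoint protected g E w x : bool :=
  if w is s :: w' then src g E s (run g w' x) && protected g E w' x else true.

Lemma protected_agree E g g' w x : agree E g g' -> protected g E w x ->
  protected g' E w x /\ run g' w x = run g w x.
Proof.
move=> gg'; elim: w => [|s w IH] /=; first by rewrite !run_nil.
case/andP=> xE /IH[-> e]; rewrite !run_cons e.
by rewrite (agree_src _ _ gg') xE (agree_move gg').
Qed.

Lemma protected_sub E E' g w x : sub_sources E E' -> protected g E w x -> protected g E' w x.
Proof.
by move=> EE'; elim: w => //= s w IH /andP[/(src_sub EE')-> /IH].
Qed.

Lemma protected_cat E g w v x : protected g E (w ++ v) x =
  protected g E w (run g v x) && protected g E v x.
Proof. by elim: w => //= s w ->; rewrite run_cat andbA. Qed.

Definition add_sources E i l := fun j => if j == i then l ++ E j else E j.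

Lemma sub_add_sources E i l : sub_sources E (add_sources E i l).
Proof. by move=> j x xE; rewrite /add_sources; case: eqP => // _; rewrite mem_cat xE orbT. Qed.

Lemma src_add_sources E g i l s x : src g (add_sources E i l) s x =
  src g E s x || (s.1 == i) && (edge g s x \in l).
Proof.
by rewrite /src /add_sources; case: eqP => _ /=; rewrite ?mem_cat ?orbF 1?orbC.
Qed.

Lemma letterP (s t : letter) : [\/ s = t, s = inv_letter t | s.1 != t.1].
Proof.
by case: s t => [[] []] [[] []]; rewrite /inv_letter /=;
  [constructor 1|constructor 2|constructor 3|constructor 3|
   constructor 2|constructor 1|constructor 3|constructor 3|
   constructor 3|constructor 3|constructor 1|constructor 2|
   constructor 3|constructor 3|constructor 2|constructor 1].
Qed.

Lemma src_edge E g s B s' x : src g (add_sources E s.1 (map (edge g s) B)) s' x ->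
  [\/ src g E s' x, s' = s /\ x \in B |
      s' = inv_letter s /\ exists2 b, b \in B & x = move g s b].
Proof.
rewrite src_add_sources => /orP[|/andP[/eqP ss']]; first by constructor 1.
case: (letterP s' s) => [->|->|]; last by rewrite ss' eqxx.
  by case/mapP=> b bB /edge_inj->; constructor 2.
by case/mapP=> b bB; rewrite -(edge_move g s b) => /edge_inj e; constructor 3; split=> //; exists b.
Qed.

Lemma src_edge_add E g s B b : b \in B -> src g (add_sources E s.1 (map (edge g s) B)) s b.
Proof. by move=> bB; rewrite src_add_sources eqxx /= map_f ?orbT. Qed.

Lemma redefine D g E s B Y : adm D -> {subset B <= Y} -> {subset vertices g E <= Y} ->
    diam_le D Y ->
  exists g', [/\ agree E g g',
    {in B & Y, forall b y,
      (forall e, src g E s e -> b <= e -> y < move g s e) -> y < move g' s b},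
    {in B & Y, forall b y, D <= d (move g' s b) y \/
      exists2 e, src g E s e & d b e + d (move g s e) y <= d (move g' s b) y} &
    {in B & Y, forall b y, d (move g' s b) y <= D}].
Proof.
move=> aD BY vY YD.
pose S := if s.2 then E s.1 else map (act (g s.1)) (E s.1).
have SP e : (e \in S) = src g E s e.
  rewrite /S /src /edge; case: ifP => // s2; apply/mapP/idP => [[x xE ->]|eE].
    have := moveK g (s.1, true) x; rewrite /inv_letter /= -s2 -surjective_pairing => K.
    by rewrite [move _ _ _]K.
  exists (move g s e) => //.
  have := moveVK g (s.1, true) e; rewrite /inv_letter /= -s2 -surjective_pairing => K.
  by rewrite -[LHS]K.
have imP e : e \in S -> move g s e \in Y by rewrite SP => /move_vertices /vY.
have [||h' [h'E o m bd]] := @push_up D (eval_letter g s) S B Y aD BY.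
- by move=> e; rewrite SP => /src_vertices /vY.
- move=> x y xY yY; apply: YD.
    by move: xY; rewrite mem_cat => /orP[//|/mapP[e /imP ? ->]].
  by move: yY; rewrite mem_cat => /orP[//|/mapP[e /imP ? ->]].
pose g' i := if i == s.1 then (if s.2 then h' else h'^-1%g) else g i.
have lg' : eval_letter g' s = h'.
  by rewrite /eval_letter /g' eqxx; case: s.2 => //=; rewrite invgK.
exists g'; split.
- move=> i x xE; rewrite /g'; case: eqP => // is1; rewrite {i}is1 in xE *.
  case: ifP => s2.
    by rewrite h'E; rewrite /S /eval_letter s2.
  have xS : act (g s.1) x \in S by rewrite /S s2 map_f.
  by rewrite -[LHS](actK h') /=; have := h'E _ xS; rewrite /eval_letter s2 actK => {1}<-; rewrite !actK.
- move=> b y bB yY H; rewrite /move lg'; apply: o => // e eS be.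
  by apply: H => //; rewrite -SP.
- move=> b y bB yY; rewrite /move lg'; case: (m b y bB yY) => [|[e eS le]]; first by left.
  by right; exists e; rewrite // -SP.
- by move=> b y bB yY; rewrite /move lg'; exact: bd.
Qed.

(** * Partial systems along a word *)

Context (A : seq X) (g0 : bool -> G).

Definition common_fix : seq X :=
  [seq c <- A | (act (g0 true) c == c) && (act (g0 false) c == c)].
Notation C := common_fix.

(** The pair [g] may still be changed away from the protected edges [E], which
    include the prescribed values on [A] and the paths of [A] along [u].  By
    [st_orbit] all protected sources come from [A]: hence a protected point fixed
    by both generators is itself in [A]. *)
Record state u g E : Prop := State {
  st_agree : agree (fun=> A) g0 g ;
  st_sub : sub_sources (fun=> A) E ;
  st_protected : {in A, forall a, protected g E u a} ;
  st_orbit : forall i, {in E i, forall e, exists a w,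
    [/\ a \in A, protected g E w a & e = run g w a]} }.

Definition extend g E s B := add_sources E s.1 (map (edge g s) B).

Record stepped D u g E s g' E' : Prop := Stepped {
  sp_state : state (s :: u) g' E' ;
  sp_agree : agree E g g' ;
  sp_edges : E' = extend g' E s (map (run g u) A) ;
  sp_lt : forall a y, a \in A -> y \in vertices g E ->
    (forall e, src g E s e -> run g u a <= e -> y < move g s e) ->
    y < move g' s (run g u a) ;
  sp_dist : forall a y, a \in A -> y \in vertices g E ->
    D <= d (move g' s (run g u a)) y \/
    exists2 e, src g E s e &
      d (run g u a) e + d (move g s e) y <= d (move g' s (run g u a)) y ;
  sp_diam : diam_le D (vertices g' E') }.

Lemma C_move u g E s c : state u g E -> c \in C -> move g s c = c.
Proof.
move=> st; rewrite mem_filter => /andP[/andP[/eqP c1 /eqP c0] cA].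
have fixi i : act (g i) c = c.
  by case: i; have := st_agree st; [rewrite -{2}c1|rewrite -{2}c0] => ->.
case: s => i [] /=; first exact: fixi.
by rewrite -{1}(fixi i); exact: (moveK g (i, true)).
Qed.

Lemma C_run u g E w c : state u g E -> c \in C -> run g w c = c.
Proof.
move=> st cC; elim: w => [|s w IH]; first by rewrite run_nil.
by rewrite run_cons IH (C_move s st cC).
Qed.

Lemma C_src u g E s c : state u g E -> c \in C -> src g E s c.
Proof.
move=> st cC; rewrite /src /edge (C_move s st cC) if_same.
by apply: (st_sub st); move: cC; rewrite mem_filter => /andP[].
Qed.

Lemma C_sub_A c : c \in C -> c \in A.
Proof. by rewrite mem_filter => /andP[]. Qed.

Lemma run_vertices u g E a : state u g E -> a \in A -> run g u a \in vertices g E.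
Proof.
move=> st aA; have := st_protected st aA; case: u st => [|s u] st /=.
  by move=> _; rewrite run_nil; apply/verticesP; exists (true, true); exact: (st_sub st).
by case/andP=> sa _; rewrite run_cons move_vertices.
Qed.

Lemma state_agree u g E g' : state u g E -> agree E g g' -> state u g' E.
Proof.
case=> gA sE tr orb gg'; split=> //.
- exact: agree_trans gA sE gg'.
- by move=> a aA; have [] := protected_agree gg' (tr a aA).
- move=> i e eE; have [a [w [aA ta ->]]] := orb i e eE.
  by have [tw rw] := protected_agree gg' ta; exists a, w; split; rewrite ?rw.
Qed.

Lemma state_extend u g E s B : state u g E ->
    {in B, forall b, exists a w, [/\ a \in A, protected g E w a & b = run g w a]} ->
  state u g (extend g E s B).
Proof.
case=> gA sE tr orb BP; have sub' : sub_sources E (extend g E s B) by exact: sub_add_sources.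
split=> //.
- exact: sub_trans sE sub'.
- by move=> a aA; apply: protected_sub sub' (tr a aA).
move=> i e; rewrite {1}/extend {1}/add_sources; case: eqP => [is1|_]; last first.
  by move=> /orb[a [w [aA ta ->]]]; exists a, w; split=> //; exact: protected_sub ta.
rewrite mem_cat is1 => /orP[/mapP[b bB ->]|]; last first.
  by move=> /orb[a [w [aA ta ->]]]; exists a, w; split=> //; exact: protected_sub ta.
have [a [w [aA /(protected_sub sub') ta be]]] := BP b bB.
rewrite /edge; case: ifP => s2; first by exists a, w; split.
exists a, (s :: w); split=> //; last by rewrite run_cons -be.
by rewrite /= -be ta andbT src_edge_add.
Qed.

Lemma vertices_extend g E s B x : {subset B <= vertices g E} ->
  x \in vertices g (extend g E s B) -> x \in vertices g E \/ exists2 b, b \in B & x = move g s b.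
Proof.
move=> BV /verticesP[t H]; case: (src_edge H) => [/src_vertices|[_ /BV]|[_ bB]]; first by left.
  by left.
by right.
Qed.

Lemma extend_word D u g E s : state u g E -> adm D -> diam_le D (vertices g E) ->
  exists g' E', stepped D u g E s g' E'.
Proof.
move=> st aD bD; pose B := map (run g u) A.
have BV : {subset B <= vertices g E} by move=> _ /mapP[a aA ->]; exact: run_vertices.
have [g' [gg' o m bd]] := redefine s aD BV (fun x => id) bD.
have st' := state_agree st gg'.
have rE a : a \in A -> run g' u a = run g u a.
  by move=> aA; have [] := protected_agree gg' (st_protected st aA).
have BV' : {subset B <= vertices g' E} by move=> b /BV; rewrite (agree_vertices _ gg').
have se : state u g' (extend g' E s B).
  apply: state_extend => // b /mapP[a aA ->]; exists a, u; split=> //.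
    exact: st_protected st' a aA.
  by rewrite rE.
have moveB a : a \in A -> run g u a \in B by move=> aA; exact: map_f.
exists g', (extend g' E s B); split=> //.
- case: se => *; split=> // a aA /=.
  by rewrite rE // src_edge_add ?moveB//=; auto.
- by move=> a y aA; apply: o; exact: moveB.
- by move=> a y aA; apply: m; exact: moveB.
move=> x y /(vertices_extend BV') xP /(vertices_extend BV') yP.
move: xP yP; rewrite !(agree_vertices _ gg') => -[xV|[b bB ->]] [yV|[b' b'B ->]].
- exact: bD.
- by rewrite dC; apply: bd.
- exact: bd.
- by rewrite dact; apply: bD; exact: BV.
Qed.

Definition barrier b e := has (fun c => b < c <= e) C.

Lemma barrierP b e : reflect (exists2 c, c \in C & b < c <= e) (barrier b e).
Proof. exact: hasP. Qed.

(** Nothing protected keeps the letter [s] from moving [b] above every vertex that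
    precedes the next common fixed point. *)
Definition unblocked g E s b := forall e, src g E s e -> b <= e -> barrier b e.

(** The letter [inv_letter r] is excluded because the last edge of the path to [b]
    is protected. *)
Definition free g E r b := forall s, s != inv_letter r -> unblocked g E s b.

Lemma stepped_src D u g E s g' E' t e : state u g E -> stepped D u g E s g' E' ->
  src g' E' t e ->
  [\/ src g E t e, t = s /\ e \in map (run g u) A |
    t = inv_letter s /\ exists2 a, a \in A & e = move g' s (run g u a)].
Proof.
move=> st sp; rewrite (sp_edges sp) => /src_edge.
rewrite (agree_src _ _ (sp_agree sp)) => -[|//|[-> [b /mapP[a aA ->] ->]]].
- by constructor 1.
- by constructor 2.
- by constructor 3; split=> //; exists a.
Qed.

(** The image has been pushed above all vertices below the next common fixed point,
    and the only new edges that start at or above it belong to the inverse letter. *)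
Lemma stepped_free D u g E s g' E' a : state u g E -> stepped D u g E s g' E' ->
  a \in A -> unblocked g E s (run g u a) -> free g' E' s (move g' s (run g u a)).
Proof.
move=> st sp aA ub t ts e te le; apply: contrapT => nb.
have eV : e \in vertices g E.
  case: (stepped_src st sp te) => [/src_vertices//|[_ /mapP[a' a'A ->]]|[tE _]].
    exact: run_vertices.
  by rewrite tE eqxx in ts.
suff : e < move g' s (run g u a) by rewrite ltNge le.
apply: (sp_lt sp) => // x xs /(ub x xs)/barrierP[c cC /andP[bc cx]].
have cm := C_move s (sp_state sp) cC; have cm' := C_move s st cC.
apply: (@lt_le_trans _ _ c); last by rewrite -cm' le_move.
rewrite ltNge; apply/negP => ce; apply: nb; apply/barrierP; exists c => //.
by rewrite ce andbT -cm lt_move.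
Qed.

(** The last clause locates the new protected edges, in order to bound how high
    they can reach in a component. *)
Lemma run_word r u g E W : state (r :: u) g E -> reduced (W ++ r :: u) ->
  exists g' E', [/\ state (W ++ r :: u) g' E', agree E g g', sub_sources E E',
    (forall a, a \in A -> free g E r (run g (r :: u) a) ->
       free g' E' (head r W) (run g' (W ++ r :: u) a)) &
    forall t e, src g' E' t e -> src g E t e \/
      exists a W1 s W2, [/\ a \in A, W = W1 ++ s :: W2, s.1 = t.1 &
        e = run g' (W2 ++ r :: u) a \/ e = run g' (s :: W2 ++ r :: u) a]].
Proof.
move=> st; elim: W => [|s W IH] red.
  by exists g, E; split=> //; [exact: sub_refl|move=> t e; left].
have {IH}[|g1 [E1 [st1 gg1 EE1 fr1 sr1]]] := IH.
  by move: red; rewrite /reduced /=; exact: path_sorted.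
have sW : s != inv_letter (head r W).
  by move: red; rewrite /reduced /=; case: (W) => [|? ?] /= /andP[].
have [D aD bD] := adm_bound actP (vertices g1 E1).
have [g2 [E2 sp]] := extend_word s st1 aD bD.
have rE a : a \in A -> run g2 (W ++ r :: u) a = run g1 (W ++ r :: u) a.
  by move=> aA; have [] := protected_agree (sp_agree sp) (st_protected st1 aA).
have rsuf W1 W2 a : a \in A -> W = W1 ++ W2 ->
    run g2 (W2 ++ r :: u) a = run g1 (W2 ++ r :: u) a.
  move=> aA WE; have := st_protected st1 aA; rewrite WE -catA protected_cat => /andP[_ tr].
  by have [] := protected_agree (sp_agree sp) tr.
exists g2, E2; split.
- exact: sp_state sp.
- exact: agree_trans gg1 EE1 (sp_agree sp).
- by apply: sub_trans EE1 _; rewrite (sp_edges sp); exact: sub_add_sources.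
- move=> a aA fra; rewrite /= run_cons rE //; apply: (stepped_free st1 sp aA).
  exact: fr1.
move=> t e /(stepped_src st1 sp)[/sr1[tE|[a [W1 [s' [W2 [aA WE s't eE]]]]]]|
    [-> /mapP[a aA ->]]|[-> [a aA ->]]].
- by left.
- right; exists a, (s :: W1), s', W2; split=> //; first by rewrite WE.
  have := rsuf (W1 ++ [:: s']) W2 a aA; rewrite -catA /= WE => /(_ erefl) ->.
  by have := rsuf W1 (s' :: W2) a aA WE; rewrite /= => ->.
- by right; exists a, [::], s, W; split=> //; left; rewrite rE.
- by right; exists a, [::], s, W; split=> //; right; rewrite run_cons rE.
Qed.

(** * Components of the complement of the common fixed points *)

(** The common fixed points cut the line into components, and both generators
    preserve each of them. *)
Definition same b e := all (fun c => ((c < b) == (c < e)) && ((b < c) == (e < c))) C.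

Lemma sameP b e : reflect {in C, forall c, (c < b) = (c < e) /\ (b < c) = (e < c)} (same b e).
Proof.
apply: (iffP allP) => H c /H; first by case/andP=> /eqP-> /eqP->.
by case=> -> ->; rewrite !eqxx.
Qed.

Lemma same_refl b : same b b. Proof. by apply/sameP. Qed.

Lemma same_trans b e x : same b e -> same b x = same e x.
Proof.
move=> /sameP be; apply/sameP/sameP => H c cC; have [<- <-] := H c cC.
  by have [<- <-] := be c cC.
by have [-> ->] := be c cC.
Qed.

Lemma same_sym b e : same b e = same e b.
Proof. by apply/idP/idP => /same_trans <-; exact: same_refl. Qed.

Lemma same_move u g E s b x : state u g E -> same b (move g s x) = same b x.
Proof.
move=> st; have H c : c \in C -> (c < move g s x) = (c < x) /\ (move g s x < c) = (x < c).
  by move=> cC; rewrite -{1 3}(C_move s st cC) !lt_move.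
apply/sameP/sameP => K c cC; first by have [-> ->] := K c cC; have [-> ->] := H c cC.
by have [-> ->] := K c cC; have [<- <-] := H c cC.
Qed.

Lemma same_run u g E w b x : state u g E -> same b (run g w x) = same b x.
Proof.
by move=> st; elim: w => [|s w IH]; rewrite ?run_nil// run_cons (same_move _ _ _ st).
Qed.

Lemma same_notC b e : same b e -> b \notin C -> e \notin C.
Proof.
move=> /sameP be; apply: contra => eC; have [] := be e eC; rewrite ltxx => eb be'.
by have -> : b = e by apply/eqP; rewrite eq_le !leNgt eb be'.
Qed.

Lemma barrier_between b e : b \notin C -> b <= e -> ~~ same b e -> barrier b e.
Proof.
move=> bC be /allPn[c cC]; rewrite negb_and => H; apply/barrierP; exists c => //.
have cb : c != b by apply: contraNneq bC => <-.
case: (ltgtP c b) cb H => // cb _.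
  by rewrite (lt_le_trans cb be) (lt_gtF (lt_le_trans cb be)).
by case: (ltgtP c e) => // ->.
Qed.

Lemma run_notC u g E w a : state u g E -> a \notin C -> run g w a \notin C.
Proof.
move=> st; apply: contra => rC.
by have := C_run w st rC; move=> /act_inj <-.
Qed.

Lemma exists_min (S : seq X) (p : pred X) : has p S ->
  exists y, [/\ y \in S, p y & forall y', y' \in S -> p y' -> y <= y'].
Proof.
elim: S => // x S IH /=; have [/IH[y [yS py ymin]] _|nS] := boolP (has p S).
  have [px|px] := boolP (p x); last first.
    exists y; split=> //; first by rewrite inE yS orbT.
    by move=> y'; rewrite inE => /orP[/eqP->|//]; [rewrite (negPf px)|exact: ymin].
  have [xy|yx] := leP x y.
    exists x; split; rewrite ?mem_head// => y'; rewrite inE => /orP[/eqP->//|y'S py'].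
    by apply: le_trans xy _; exact: ymin.
  exists y; split=> //; first by rewrite inE yS orbT.
  by move=> y'; rewrite inE => /orP[/eqP-> _|]; [exact: ltW|exact: ymin].
rewrite orbF => px; exists x; split; rewrite ?mem_head// => y'.
by rewrite inE => /orP[/eqP->//|y'S py']; case/hasP: nS; exists y'.
Qed.

(** A point fixed by both generators is fixed by all words, so it coincides with
    the point of [A] from which it is reached. *)
Lemma two_fixed u g E y : state u g E -> y \notin C ->
  y \in E true -> act (g true) y = y -> act (g false) y != y.
Proof.
move=> st yC yE g1; apply/eqP => g2; case/negP: yC.
have fixi s : move g s y = y.
  have fixi i : act (g i) y = y by case: i.
  case: s => i [] /=; first exact: fixi.
  by rewrite -{1}(fixi i); exact: (moveK g (i, true)).
have [a [w [aA _ yE']]] := st_orbit st yE.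
have ya : y = a.
  have : run g w y = y by elim: (w) => [|s w' IH]; rewrite ?run_nil// run_cons IH.
  by rewrite {2}yE' => /act_inj.
rewrite mem_filter ya aA andbT; rewrite ya in g1 g2.
by rewrite -(st_agree st aA) -(st_agree st aA) g1 g2 !eqxx.
Qed.

(** If an edge of generator i starting at or above y ends at or below y, and one of
    its inverse does too, then monotonicity forces both edges to be the loop at y. *)
Lemma pushing_letter g E i y : ~~ ((y \in E i) && (act (g i) y == y)) ->
  exists s : letter, s.1 = i /\ forall e, src g E s e -> y <= e -> y < move g s e.
Proof.
move=> nfix; apply: contrapT => H.
have blk eps : exists e, [/\ src g E (i, eps) e, y <= e & move g (i, eps) e <= y].
  apply: contrapT => K; apply: H; exists (i, eps); split=> // e se ye.
  by rewrite ltNge; apply/negP => le; apply: K; exists e.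
have [e [e1 ye ey]] := blk true; have [e' [e'1 ye' e'y]] := blk false.
have e'E : move g (i, true) (move g (i, false) e') = e' := moveVK g (i, true) e'.
have e'e : move g (i, false) e' <= e by exact: le_trans e'y ye.
have le2 : e' <= move g (i, true) e by rewrite -[e']e'E le_move.
have yE : move g (i, true) e = y.
  by apply/eqP; rewrite eq_le ey; exact: le_trans ye' le2.
have e'y2 : e' = y by apply/eqP; rewrite eq_le ye' andbT -yE.
have ee : e = move g (i, false) e'.
  by apply: (@move_inj g (i, true)); rewrite e'E e'y2.
have ey2 : e = y by apply/eqP; rewrite eq_le ye andbT ee.
rewrite ey2 in e1 yE; case/negP: nfix; apply/andP; split; first exact: e1.
by apply/eqP; exact: yE.
Qed.

(** * Climbing to the top of a component *)

Section Climb.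
Context (r : letter) (u : word) (g : bool -> G) (E : bool -> seq X) (a1 : X).
Context (st : state (r :: u) g E) (red_u : reduced (r :: u)) (a1A : a1 \in A) (a1C : a1 \notin C).

Let b1 := run g (r :: u) a1.
Let P := [seq y <- vertices g E | same b1 y].

(** The orbit of [a1] is followed alone, up to a point [x] such that, apart from
    the initial vertices [P], all vertices of its component lie at or below [x]. *)
Record climbing v g' E' x : Prop := Climbing {
  cl_agree : agree E g g' ;
  cl_sub : sub_sources E E' ;
  cl_state : state (r :: u) g' E' ;
  cl_protected : protected g' E' (v ++ r :: u) a1 ;
  cl_end : x = run g' (v ++ r :: u) a1 ;
  cl_red : reduced (v ++ r :: u) ;
  cl_new : forall s e, src g' E' s e -> src g E s e \/ same b1 e ;
  cl_vertices : forall e, e \in vertices g' E' -> same b1 e -> e \in P \/ e <= x ;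
  cl_leaf : forall s, s != inv_letter (head r v) -> src g' E' s x -> x \in P }.

Let b1C : b1 \notin C.
Proof. exact: run_notC st a1C. Qed.

Lemma climbing_same v g' E' x : climbing v g' E' x -> same b1 x.
Proof.
move=> cl; rewrite (cl_end cl) (same_run _ _ _ (cl_state cl)).
by rewrite -(same_run (r :: u) _ _ st) same_refl.
Qed.

Lemma climbing_start : climbing [::] g E b1.
Proof.
have b1V := run_vertices st a1A.
have b1P : b1 \in P by rewrite mem_filter same_refl.
split=> //=; rewrite ?(st_protected st)//.
- exact: sub_refl.
- exact: (st_protected st a1A).
- by move=> s e; left.
- by move=> e eV eK; left; rewrite mem_filter eK.
Qed.

Lemma climbing_back v g' E' x : climbing v g' E' x ->
  src g' E' (inv_letter (head r v)) x.
Proof.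
move=> cl; have := cl_protected cl; rewrite (cl_end cl); case: (v) => [|s w] /= /andP[H _].
  by rewrite run_cons src_move.
by rewrite run_cons src_move.
Qed.

Lemma above_component v g' E' x s e y : climbing v g' E' x -> same b1 y ->
  ~~ same b1 e -> x <= e -> y < move g' s e.
Proof.
move=> cl yK eK xe; have xK := climbing_same cl.
have xC := same_notC xK b1C.
have /barrierP[c cC /andP[xc ce]] : barrier x e.
  by apply: barrier_between => //; rewrite -(same_trans _ xK).
apply: (@lt_le_trans _ _ c); last by rewrite -{1}(C_move s (cl_state cl) cC) le_move.
have /sameP/(_ c cC)[_ <-] : same x y by rewrite -(same_trans _ xK).
by [].
Qed.

Lemma climbing_step v g' E' x s : climbing v g' E' x -> s != inv_letter (head r v) ->
  exists g'', [/\ agree E' g' g'',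
    (forall y, y \in vertices g' E' ->
      (forall e, src g' E' s e -> x <= e -> y < move g' s e) -> y < move g'' s x) &
    x <= move g'' s x -> (move g'' s x = x -> x \in P) ->
      climbing (s :: v) g'' (extend g'' E' s [:: x]) (move g'' s x)].
Proof.
move=> cl sv; have xV : x \in vertices g' E' by exact: src_vertices (climbing_back cl).
have [D aD bD] := adm_bound actP (vertices g' E').
have BV : {subset [:: x] <= vertices g' E'} by move=> z; rewrite inE => /eqP->.
have [g'' [gg' o _ _]] := redefine s aD BV (fun z => id) bD.
exists g''; split=> //; first by move=> y yV; apply: o => //; rewrite mem_head.
set x'' := move g'' s x; set E'' := extend _ _ _ _ => xx'' xP.
have [tr rE] := protected_agree gg' (cl_protected cl).
have subE : sub_sources E' E'' by exact: sub_add_sources.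
have st' : state (r :: u) g'' E''.
  apply: state_extend; first exact: state_agree (cl_state cl) gg'.
  move=> b; rewrite inE => /eqP->; exists a1, (v ++ r :: u); split=> //.
  by rewrite rE (cl_end cl).
have xE : x = run g'' (v ++ r :: u) a1 by rewrite rE (cl_end cl).
have sx : src g'' E'' s x by exact: src_edge_add (mem_head _ _).
have srcE t e : src g'' E'' t e ->
    [\/ src g' E' t e, t = s /\ e = x | t = inv_letter s /\ e = x''].
  move=> /src_edge; rewrite (agree_src _ _ gg') => -[|[-> ]|[-> [z]]].
  - by constructor 1.
  - by rewrite inE => /eqP->; constructor 2.
  - by rewrite inE => /eqP-> ->; constructor 3.
have xK := climbing_same cl.
have x''K : same b1 x'' by rewrite (same_move _ _ _ st').
have PleP e : e \in P -> e \in P \/ e <= x'' by left.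
split=> //.
- exact: agree_trans (cl_agree cl) (cl_sub cl) gg'.
- exact: sub_trans (cl_sub cl) subE.
- by rewrite /= -xE sx (protected_sub subE tr).
- by rewrite /= run_cons -xE.
- have := cl_red cl; rewrite /reduced /=; case: (v) sv => [|t w] /= ->; exact: id.
- move=> t e /srcE[/(cl_new cl)//|[_ ->]|[_ ->]]; by right.
- move=> e /verticesP[t /srcE[/src_vertices eV eK|[_ ->] _|[_ ->] _]].
  + case: (cl_vertices cl eV eK); first by left.
    by move=> ex; right; exact: le_trans ex xx''.
  + by right.
  + by right.
move=> t ts /srcE[tx|[_ e]|[te]]; last by rewrite te eqxx in ts.
  case: (cl_vertices cl (src_vertices tx) x''K) => // x''x.
  have e : x'' = x by apply/eqP; rewrite eq_le x''x xx''.
  by rewrite e; exact: xP.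
by rewrite -/x'' in e; rewrite e; exact: xP.
Qed.

Lemma not_fixed_twice v g' E' x y i : climbing v g' E' x -> y \in P ->
  (y \in E' (~~ i)) && (act (g' (~~ i)) y == y) ->
  ~~ ((y \in E' i) && (act (g' i) y == y)).
Proof.
move=> cl; rewrite mem_filter => /andP[yK _] /andP[y1 /eqP f1].
have yC := same_notC yK b1C.
apply/negP => /andP[y2 /eqP f2]; have tf := @two_fixed _ _ _ y (cl_state cl) yC.
by case: i y1 y2 f1 f2 => /= y1 y2 f1 f2;
  [have := tf y2 f2; rewrite f1 eqxx|have := tf y1 f1; rewrite f2 eqxx].
Qed.

(** The obstacle [y] is the first initial vertex at or above [x], so an edge of [s]
    starting at or above [x] also starts at or above [y]. *)
Lemma pass_with v g' E' x y s : climbing v g' E' x -> y \in P -> x <= y ->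
    (forall y', y' \in P -> x <= y' -> y <= y') -> s != inv_letter (head r v) ->
    (forall e, src g' E' s e -> y <= e -> y < move g' s e) ->
  exists v' g'' E'' x', climbing v' g'' E'' x' /\ y < x'.
Proof.
move=> cl yP xy ymin sv push; have [g'' [gg' o cl']] := climbing_step cl sv.
have [yK yV] : same b1 y /\ y \in vertices g E by move: yP; rewrite mem_filter => /andP.
suff yx : y < move g'' s x.
  exists (s :: v), g'', (extend g'' E' s [:: x]), (move g'' s x); split=> //.
  apply: cl'; first by rewrite ltW // (le_lt_trans xy).
  by move=> e; move: yx; rewrite e ltNge xy.
apply: o => [|e se xe].
  by rewrite -(agree_vertices _ (cl_agree cl)) in yV; exact: sub_vertices (cl_sub cl) _ yV.
have [eK|eK] := boolP (same b1 e); last exact: above_component cl _ eK xe.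
apply: push => //; case: (cl_vertices cl (src_vertices se) eK) => [eP|ex]; first exact: ymin.
have ex' : e = x by apply/eqP; rewrite eq_le ex xe.
by rewrite ex'; apply: ymin => //; apply: (cl_leaf cl sv); rewrite -ex'.
Qed.

(** Unless the other generator fixes [y], one of its letters pushes [y] up and may
    follow the last letter used.  If it does fix [y], then the letter that pushes
    [y] up might be the inverse of the last one; moving first along the other
    generator, which leads to a point between [x] and [y], makes it available. *)
Lemma pass_obstacle v g' E' x y : climbing v g' E' x -> y \in P -> x <= y ->
    (forall y', y' \in P -> x <= y' -> y <= y') ->
  exists v' g'' E'' x', climbing v' g'' E'' x' /\ y < x'.
Proof.
move=> cl yP xy ymin; pose j := ~~ (head r v).1.
have jv t : t.1 = j -> t != inv_letter (head r v).
  by move=> tj; apply/eqP => e; move: tj; rewrite e /j /=; case: (head r v).1.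
(* The generator [j] differs from that of the last letter, so both its letters may follow. *)
have [fj|nfj] := boolP ((y \in E' j) && (act (g' j) y == y)); last first.
  have [s [sj push]] := pushing_letter nfj.
  exact: (pass_with cl yP xy ymin (jv s sj) push).
pose t : letter := (j, true).
have [g'' [gg' o cl']] := climbing_step cl (jv t erefl).
have yK : same b1 y by move: yP; rewrite mem_filter => /andP[].
have [yE /eqP ty] := andP fj.
have ty' : move g'' t y = y by rewrite -{2}ty; exact: gg'.
set x' := move g'' t x; have x'y : x' <= y by rewrite -ty' le_move.
have xx' : x <= x' /\ (x' = x -> x \in P).
  have [xy'|/eqP] := eqVneq x y; first by rewrite /x' xy' ty'.
  move/eqP => nxy; have {nxy}lxy : x < y by rewrite lt_neqAle nxy.
  suff lt : x < x' by split; [exact: ltW|move=> e; move: lt; rewrite e ltxx].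
  apply: o => [|e se xe]; first exact: src_vertices (climbing_back cl).
  have [eK|eK] := boolP (same b1 e); last first.
    exact: (above_component _ cl (climbing_same cl) eK xe).
  have ye : y <= e.
    case: (cl_vertices cl (src_vertices se) eK) => [eP|ex]; first exact: ymin.
    have ex' : e = x by apply/eqP; rewrite eq_le ex xe.
    by rewrite ex'; apply: ymin => //; apply: (cl_leaf cl (jv t erefl)); rewrite -ex'.
  have ty1 : move g' t y = y := ty.
  by apply: (lt_le_trans lxy); rewrite -{1}ty1 le_move.
have {cl'}cl' := cl' xx'.1 xx'.2.
have fj' : (y \in extend g'' E' t [:: x] j) && (act (g'' j) y == y).
  by apply/andP; split; [exact: (@sub_add_sources E' _ _ j y yE)|apply/eqP; exact: ty'].

have := not_fixed_twice (i := ~~ j) cl' yP; rewrite negbK => /(_ fj') nfi'.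
have [s [si push]] := pushing_letter nfi'.
apply: (pass_with cl' yP x'y _ _ push) => [y' y'P x'y'|].
  by apply: ymin => //; exact: le_trans xx'.1 x'y'.
by apply/eqP => e; move: si; rewrite e /= /t; case: (j).
Qed.

Lemma climb_top : exists v g' E' x, climbing v g' E' x /\ {in P, forall y, y < x}.
Proof.
suff H n : forall v g' E' x, climbing v g' E' x -> (count (fun y => x <= y)%O P <= n)%N ->
    exists v g' E' x, climbing v g' E' x /\ {in P, forall y, y < x}.
  exact: (H _ _ _ _ _ climbing_start (leqnn _)).
elim: n => [|n IH] v g' E' x cl cnt;
    (have [hP|nP] := boolP (has (fun y => x <= y) P); last first).
- exists v, g', E', x; split=> // y yP; rewrite ltNge; apply/negP => xy.
  by case/hasP: nP; exists y.
- by move: hP; rewrite has_count ltnNge cnt.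
- exists v, g', E', x; split=> // y yP; rewrite ltNge; apply/negP => xy.
  by case/hasP: nP; exists y.
have [y [yP xy ymin]] := exists_min hP.
have [v' [g'' [E'' [x' [cl' yx']]]]] := pass_obstacle cl yP xy ymin.
apply: (IH v' g'' E'' x' cl'); rewrite -ltnS; apply: leq_trans cnt.
apply: (count_lt (y := y)) => //; last by rewrite -ltNge.
by move=> z _ x'z; exact: le_trans xy (le_trans (ltW yx') x'z).
Qed.

(** From the top, repeating one letter [s] outruns every word: the points [z]
    reached after [j] repetitions bound the effect of all words shorter than [j]. *)
Record chain s v x j g' E' z : Prop := Chain {
  ch_agree : agree E g g' ;
  ch_sub : sub_sources E E' ;
  ch_state : state (r :: u) g' E' ;
  ch_protected : protected g' E' (nseq j s ++ v ++ r :: u) a1 ;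
  ch_end : z = run g' (nseq j s ++ v ++ r :: u) a1 ;
  ch_new : forall t e, src g' E' t e -> src g E t e \/ same b1 e ;
  ch_vertices : forall e, e \in vertices g' E' -> same b1 e -> e <= z ;
  ch_low : x <= z ;
  ch_leaf : ~~ src g' E' s z ;
  ch_back : src g' E' (inv_letter s) z ;
  ch_other : forall t e, t.1 != s.1 -> src g' E' t e -> same b1 e -> e < z ;
  ch_short : forall g'' w b, agree E' g' g'' -> same b1 b -> b <= x ->
    (size w < j)%N -> run g'' w b < z }.

Lemma neq_inv_letter (s : letter) : s != inv_letter s.
Proof. by case: s => [[] []]. Qed.

Lemma chain_start v g' E' x : climbing v g' E' x -> {in P, forall y, y < x} ->
  chain (head r v) v x 0 g' E' x.
Proof.
move=> cl Px; have nP : x \notin P by apply/negP => /Px; rewrite ltxx.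
have leV e : e \in vertices g' E' -> same b1 e -> e <= x.
  by move=> eV eK; case: (cl_vertices cl eV eK) => // /Px/ltW.
have leaf s : s != inv_letter (head r v) -> ~~ src g' E' s x.
  by move=> sv; apply: contra nP; exact: (cl_leaf cl).
split=> //; try by case: cl.
- by apply: leaf; exact: neq_inv_letter.
- exact: climbing_back.
move=> t e tv te eK; rewrite lt_neqAle leV ?andbT//; last exact: src_vertices te.
apply: contraTneq te => ->; apply: leaf; apply: contraNneq tv => ->.
by [].
Qed.

(** Before the next repetition both edges of the other generator at [z] are
    protected too; the new point is placed above their ends. *)
Lemma chain_step s v x j g' E' z : chain s v x j g' E' z ->
  exists g'' E'' z', chain s v x j.+1 g'' E'' z'.
Proof.
move=> ch; pose t (q : bool) : letter := (~~ s.1, q).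
have ts q : (t q).1 != s.1 by rewrite /t /=; case: s.1.
have zV : z \in vertices g' E' by exact: src_vertices (ch_back ch).
pose E1 := extend g' (extend g' E' (t true) [:: z]) (t false) [:: z].
have orbz E2 : sub_sources E' E2 -> {in [:: z], forall b, exists a w,
    [/\ a \in A, protected g' E2 w a & b = run g' w a]}.
  move=> sE b; rewrite inE => /eqP->; exists a1, (nseq j s ++ v ++ r :: u).
  by split=> //; [exact: protected_sub sE (ch_protected ch)|exact: ch_end ch].
have sub1 : sub_sources E' E1 := sub_trans (@sub_add_sources _ _ _) (@sub_add_sources _ _ _).
have st1 : state (r :: u) g' E1.
  apply: state_extend; first by apply: (state_extend _ (ch_state ch)); exact: orbz (@sub_refl _).
  by apply: orbz; exact: sub_add_sources.
have src1 p e : src g' E1 p e ->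
    src g' E' p e \/ p.1 != s.1 /\ (e = z \/ exists q, e = move g' q z).
  move=> /src_edge[/src_edge[|[-> ]|[-> [b]]]|[->]|[-> [b]]].
  - by left.
  - by rewrite inE => /eqP->; right; split; [exact: ts|left].
  - by rewrite inE => /eqP-> ->; right; split; [exact: ts|right; exists (t true)].
  - by rewrite inE => /eqP->; right; split; [exact: ts|left].
  - by rewrite inE => /eqP-> ->; right; split; [exact: ts|right; exists (t false)].
have zK : same b1 z.
  rewrite (ch_end ch) (same_run _ _ _ (ch_state ch)).
  by rewrite -(same_run (r :: u) _ _ st) same_refl.
have zC := same_notC zK b1C.
have srcs e : src g' E1 s e -> src g' E' s e.
  by move=> /src1[//|[]]; rewrite eqxx.
have zV1 : z \in vertices g' E1 by exact: sub_vertices sub1 _ zV.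
have [D aD bD] := adm_bound actP (vertices g' E1).
have BV : {subset [:: z] <= vertices g' E1} by move=> y; rewrite inE => /eqP->.
have [g'' [gg' o _ _]] := redefine s aD BV (fun y => id) bD.
set z' := move g'' s z.
have push_up y : y \in vertices g' E1 -> same b1 y -> y < z'.
  move=> yV yK; apply: o; rewrite ?mem_head// => e /srcs se ze.
  have [eK|eK] := boolP (same b1 e).
    have ez : e = z by apply/eqP; rewrite eq_le ze (ch_vertices ch) // (src_vertices se).
    by move: (ch_leaf ch); rewrite -ez se.
  have /barrierP[c cC /andP[zc ce]] : barrier z e.
    by apply: barrier_between => //; rewrite -(same_trans _ zK).
  apply: (@lt_le_trans _ _ c); last by rewrite -{1}(C_move s st1 cC) le_move.
  have /sameP/(_ c cC)[_ <-] : same z y by rewrite -(same_trans _ zK).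
  by [].
have zz' : z < z' by exact: push_up.
pose E2 := extend g'' E1 s [:: z].
have sub2 : sub_sources E1 E2 by exact: sub_add_sources.
have [tr rE] := protected_agree gg' (protected_sub sub1 (ch_protected ch)).
have st2 : state (r :: u) g'' E2.
  apply: state_extend; first exact: state_agree st1 gg'.
  move=> b; rewrite inE => /eqP->; exists a1, (nseq j s ++ v ++ r :: u).
  by split=> //; rewrite rE; exact: ch_end ch.
have z'K : same b1 z' by rewrite (same_move _ _ _ st2).
have src2 p e : src g'' E2 p e ->
    [\/ src g' E1 p e, p = s /\ e = z | p = inv_letter s /\ e = z'].
  move=> /src_edge; rewrite (agree_src _ _ gg') => -[|[-> ]|[-> [b]]].
  - by constructor 1.
  - by rewrite inE => /eqP->; constructor 2.
  - by rewrite inE => /eqP-> ->; constructor 3.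
have sz : src g'' E2 s z by exact: src_edge_add (mem_head _ _).
exists g'', E2, z'; split.
- by apply: agree_trans (ch_agree ch) (ch_sub ch) _ => i y /sub1; exact: gg'.
- exact: sub_trans (ch_sub ch) (sub_trans sub1 sub2).
- exact: st2.
- by rewrite /= rE -(ch_end ch) sz (protected_sub sub2 tr).
- by rewrite /= run_cons rE -(ch_end ch).
- move=> p e /src2[/src1[/(ch_new ch)//|[_ [->|[q ->]]]]|[_ ->]|[_ ->]]; right => //.
  by rewrite (same_move _ _ _ st1).
- by move=> e /verticesP[p /src2[/src_vertices eV eK|[_ ->] _|[_ ->] _]] //; apply: ltW => //; exact: push_up.
- exact: le_trans (ch_low ch) (ltW zz').
- apply/negP => /src2[/src_vertices/push_up/(_ z'K)|[_ e]|[e _]].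
  + by rewrite ltxx.
  + by move: zz'; rewrite -/z' e ltxx.
  + by have := neq_inv_letter s; rewrite -e eqxx.
- by rewrite src_move.
- move=> p e ps /src2[/src_vertices eV eK|[e1]|[e1]]; first exact: push_up.
    by rewrite e1 eqxx in ps.
  by rewrite e1 eqxx in ps.
move=> g3 w b gg3 bK bx; case: w => [|p w] /=.
  by move=> _; rewrite run_nil; exact: le_lt_trans bx (le_lt_trans (ch_low ch) zz').
rewrite ltnS => wj; rewrite run_cons.
have ag3 : agree E' g' g3.
  by apply: (agree_trans (E' := E2)) gg3 => [i y /sub1|]; [exact: gg'|exact: sub_trans sub1 sub2].
have := ch_short ch ag3 bK bx wj; rewrite -(lt_move g3 p) => /lt_le_trans; apply.
case: (letterP p s) => [->|->|ps].
- by rewrite (agree_move gg3 sz).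
- rewrite (agree_move ag3 (ch_back ch)); apply: le_trans (ltW zz').
  by apply: (ch_vertices ch); rewrite ?move_vertices ?(ch_back ch)// (same_move _ _ _ (ch_state ch)).
have pt : p = t p.2 by case: p ps => i q /=; rewrite /t; case: i; case: s.1.
have pz : src g' E1 p z.
  rewrite pt; case: p.2; last exact: src_edge_add (mem_head _ _).
  by apply: src_sub (@sub_add_sources _ _ _) _; exact: src_edge_add (mem_head _ _).
have ag1 : agree E1 g' g3 by exact: agree_trans gg' sub2 gg3.
by rewrite (agree_move ag1 pz) ltW// push_up ?move_vertices// (same_move _ _ _ st1).
Qed.

Lemma chain_exists : exists v x, [/\ reduced (v ++ r :: u), {in P, forall y, y < x} &
  forall j, exists g' E' z, chain (head r v) v x j g' E' z].
Proof.
have [v [g' [E' [x [cl Px]]]]] := climb_top.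
exists v, x; split=> //; first exact: cl_red cl.
elim=> [|j [g'' [E'' [z ch]]]]; last exact: chain_step ch.
by exists g', E', x; exact: chain_start.
Qed.

Lemma reduced_nseq s v k : s = head r v -> reduced (v ++ r :: u) ->
  reduced (nseq k s ++ v ++ r :: u).
Proof.
move=> sv red; elim: k => //= k; rewrite /reduced /=.
case: k => [|k] /=; last by rewrite neq_inv_letter.
by rewrite sv; case: (v) red => [|t w] /= red; rewrite neq_inv_letter.
Qed.

Lemma size_suffix_cat (W1 W2 v : word) k s t : t != s ->
  nseq k s ++ v = W1 ++ t :: W2 -> (size (t :: W2) <= size v)%N.
Proof.
elim: k W1 => [|k IH] [|t' W1] ts //=.
- by move=> ->.
- by move=> ->; rewrite /= size_cat /= addnS ltnS ltnW// ltnS leq_addl.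
- by case=> e _; rewrite e eqxx in ts.
- by case=> _; exact: IH.
Qed.

(** The lowest point of the component climbs to the top and is then moved by
    [size v + 1] repetitions of its last letter.  While [v] is read the other
    points of the component stay below the end of the chain, so no edge of the
    other generator reaches that height, and that generator is free to act on all
    points at or above the end of the chain. *)
Lemma free_component :
    (forall a, a \in A -> same b1 (run g (r :: u) a) -> b1 <= run g (r :: u) a) ->
  exists W g' E', [/\ reduced (W ++ r :: u), state (W ++ r :: u) g' E' &
    forall a, a \in A -> a \notin C ->
      same b1 (run g (r :: u) a) \/ free g E r (run g (r :: u) a) ->
      free g' E' (head r W) (run g' (W ++ r :: u) a)].
Proof.
move=> b1min; have [v [x [redv Px chP]]] := chain_exists.
set s := head r v in chP; pose n := size v.
have [g1 [E1 [z ch]]] := chP n.+1; pose W := nseq n.+1 s ++ v.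
have WE : W ++ r :: u = nseq n.+1 s ++ v ++ r :: u by rewrite /W -catA.
have redW : reduced (W ++ r :: u) by rewrite WE; exact: reduced_nseq.
have [g2 [E2 [st2 gg2 sub2 fr2 src2]]] := run_word (ch_state ch) redW.
have pos1 a : a \in A -> run g1 (r :: u) a = run g (r :: u) a.
  by move=> aA; have [] := protected_agree (ch_agree ch) (st_protected st aA).
have pos2 a : a \in A -> run g2 (r :: u) a = run g (r :: u) a.
  by move=> aA; have [_ ->] := protected_agree gg2 (st_protected (ch_state ch) aA); exact: pos1.
have st2' := state_agree (ch_state ch) gg2.
have sameW w a : a \in A -> same b1 (run g2 (w ++ r :: u) a) = same b1 (run g (r :: u) a).
  by move=> aA; rewrite run_cat (same_run _ _ _ st2') pos2.
pose t : letter := (~~ s.1, true).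
have ts : t.1 != s.1 by rewrite /t /=; case: s.1.
have headW : head r W = s by [].
have zW : run g2 (W ++ r :: u) a1 = z.
  have := ch_protected ch; rewrite -WE => /(protected_agree gg2)[_ ->].
  by rewrite WE -(ch_end ch).
have ubK a : a \in A -> same b1 (run g (r :: u) a) ->
    unblocked g2 E2 t (run g2 (W ++ r :: u) a).
  move=> aA aK; set b := run g2 _ a.
  have bK : same b1 b by rewrite sameW.
  have zb : z <= b.
    by rewrite -zW /b (run_cat _ W) (run_cat _ W) le_run !pos2//; exact: b1min.
  move=> e se be; have [eK|eK] := boolP (same b1 e); last first.
    apply: barrier_between; first exact: same_notC bK b1C.
      exact: be.
    by rewrite -(same_trans _ bK).
  suff : e < z by rewrite ltNge (le_trans zb be).
  case: (src2 _ _ se) => [/(ch_other ch ts)/(_ eK)//|].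
  move=> [a' [W1 [s' [W2 [a'A WE' s't eE]]]]].
  have s's : s' != s by apply: contraNneq ts => <-; rewrite s't.
  have szW := size_suffix_cat s's WE'.
  have aK' : same b1 (run g (r :: u) a').
    move: eK; case: eE => ->; first by rewrite sameW.
    by rewrite -cat_cons sameW.
  have ax : run g (r :: u) a' <= x.
    by apply/ltW/Px; rewrite mem_filter aK' run_vertices.
  have short w : (size w <= size v)%N -> run g2 (w ++ r :: u) a' < z.
    move=> wv; rewrite run_cat pos2//.
    by apply: (ch_short ch gg2) => //; rewrite ltnS.
  by case: eE => ->; [apply: short; exact: ltnW|rewrite -cat_cons; exact: short].
have [D aD bD] := adm_bound actP (vertices g2 E2).
have [g3 [E3 sp]] := extend_word t st2 aD bD.
exists (t :: W), g3, E3; split; last 1 first.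
- move=> a aA aC aP /=; rewrite run_cons.
  have -> : run g3 (W ++ r :: u) a = run g2 (W ++ r :: u) a.
    by have [] := protected_agree (sp_agree sp) (st_protected st2 aA).
  apply: (stepped_free st2 sp aA).
  have [aK|aK] := boolP (same b1 (run g (r :: u) a)); first exact: ubK.
  have {aP} fra : free g E r (run g (r :: u) a).
    by case: aP => // aK'; rewrite aK' in aK.
  have bC := run_notC (r :: u) st aC.
  suff fr1 : free g1 E1 r (run g1 (r :: u) a).
    apply: (fr2 a aA fr1); rewrite headW.
    by apply: contraNneq ts => ->.
  rewrite pos1// => p pr e /(ch_new ch)[pe|eK] be; first exact: (fra p pr e pe be).
  by apply: barrier_between => //; apply: contra aK => be'; rewrite same_sym (same_trans _ be') same_sym.
- rewrite cat_cons; apply: reduced_cons => //; rewrite headW.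
  by apply: contraNneq ts => ->.
exact: sp_state sp.
Qed.

End Climb.

Lemma all_free r u g E : state (r :: u) g E -> reduced (r :: u) ->
  exists W g' E', [/\ reduced (W ++ r :: u), state (W ++ r :: u) g' E' &
    forall a, a \in A -> a \notin C -> free g' E' (head r W) (run g' (W ++ r :: u) a)].
Proof.
suff H n : forall r u g E, state (r :: u) g E -> reduced (r :: u) ->
  (count (fun a => (a \notin C) && ~~ `[< free g E r (run g (r :: u) a) >]) A <= n)%N ->
  exists W g' E', [/\ reduced (W ++ r :: u), state (W ++ r :: u) g' E' &
    forall a, a \in A -> a \notin C -> free g' E' (head r W) (run g' (W ++ r :: u) a)].
  by move=> st red; exact: H st red (leqnn _).
elim: n => {r u g E} [|n IH] r u g E st red cnt;
    (have [hP|nP] := boolP (has (fun a => (a \notin C) &&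
       ~~ `[< free g E r (run g (r :: u) a) >]) A); last first).
- exists [::], g, E; split=> // a aA aC; apply: contrapT => nf.
  by case/hasP: nP; exists a => //; rewrite aC; apply/asboolPn.
- by move: hP; rewrite has_count ltnNge cnt.
- exists [::], g, E; split=> // a aA aC; apply: contrapT => nf.
  by case/hasP: nP; exists a => //; rewrite aC; apply/asboolPn.
case/hasP: hP => a aA /andP[aC /asboolPn naf].
pose b := run g (r :: u) a.
have [|y [yS yK ymin]] := @exists_min (map (run g (r :: u)) A) (same b).
  by apply/hasP; exists b; [exact: map_f|exact: same_refl].
have [a1 a1A yE] := mapP yS; rewrite yE in yK ymin => {yS y yE}.
have a1C : a1 \notin C.
  have bC : b \notin C := run_notC _ st aC.
  apply: contra (same_notC yK bC) => a1C.
  by rewrite (C_run _ st a1C).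
have [|W [g1 [E1 [red1 st1 fr1]]]] := free_component st red a1A a1C.
  by move=> a' a'A a'K; apply: ymin; [exact: map_f|rewrite (same_trans _ yK)].
have [r1 [u1 WE]] : exists r1 u1, W ++ r :: u = r1 :: u1 /\ r1 = head r W.
  by case: (W) => [|p w] /=; [exists r, u|exists p, (w ++ r :: u)].
case: WE => WE r1E; rewrite WE in red1 st1 fr1; rewrite -r1E in fr1.
have [|W' [g2 [E2 [red2 st2 fr2]]]] := IH r1 u1 g1 E1 st1 red1.
  rewrite -ltnS; apply: leq_trans cnt; apply: (count_lt (y := a)) => //.
  - move=> a' a'A /andP[a'C /asboolPn nf]; rewrite a'C; apply/asboolPn => f.
    by apply: nf; apply: fr1 => //; right.
  - by rewrite aC; apply/asboolPn.
  - by rewrite aC /= negbK; apply/asboolP; apply: fr1 => //; left; rewrite -(same_trans _ yK) same_refl.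
exists (W' ++ W), g2, E2; rewrite -catA WE; split=> // a' a'A a'C.
have -> : head r (W' ++ W) = head r1 W' by rewrite r1E; case: (W').
exact: fr2.
Qed.

(** * Pushing images apart *)

(** A lower bound [rho] on a distance, truncated twice: no distance is made larger
    than [D], and distances through common fixed points cannot be increased. *)
Definition far D rho b e :=
  [\/ D <= d b e, rho <= d b e | exists2 c, c \in C & d b c + d c e <= d b e].

Definition apart D rho r u g E := forall a, a \in A -> a \notin C ->
  free g E r (run g (r :: u) a) /\
  forall s e, s != inv_letter r -> src g E s e -> far D rho (run g (r :: u) a) e.

Lemma stepped_src_vertices D u g E s g' E' t e : state u g E -> stepped D u g E s g' E' ->
  t != inv_letter s -> src g' E' t e -> e \in vertices g E.
Proof.
move=> st sp ts /(stepped_src st sp)[/src_vertices//|[_ /mapP[a aA ->]]|[e1]].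
  exact: run_vertices.
by rewrite e1 eqxx in ts.
Qed.

Lemma stepped_run D u g E s g' E' a : state u g E -> stepped D u g E s g' E' ->
  a \in A -> run g' u a = run g u a.
Proof. by move=> st sp aA; have [] := protected_agree (sp_agree sp) (st_protected st aA). Qed.

(** Lower bounds on distances are inherited by the truncated free amalgam. *)
Lemma far_through D rho u g E s g' E' a e y : state u g E -> stepped D u g E s g' E' ->
    far D rho (run g u a) e ->
    d (run g u a) e + d (move g s e) y <= d (move g' s (run g u a)) y ->
  far D rho (move g' s (run g u a)) y.
Proof.
move=> st sp fe le; have := dist_ge0 (move g s e) y.
case: fe => [De|re|[c cC ce]] ge.
- by constructor 1; lra.
- by constructor 2; lra.
constructor 3; exists c => //.
have -> : d (move g' s (run g u a)) c = d (run g u a) c.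
  by rewrite -{1}(C_move s (sp_state sp) cC) [LHS]dact.
have := dtri c (move g s e) y.
have -> : d c (move g s e) = d c e by rewrite -{1}(C_move s st cC) [LHS]dact.
by lra.
Qed.

Lemma apart_step D rho r u g E s g' E' : state (r :: u) g E -> apart D rho r u g E ->
  s != inv_letter r -> stepped D (r :: u) g E s g' E' -> apart D rho s (r :: u) g' E'.
Proof.
move=> st ap sr sp a aA aC; have [fra far_a] := ap a aA aC.
rewrite run_cons (stepped_run st sp aA); split.
  by apply: (stepped_free st sp aA); exact: fra.
move=> t e ts te; have eV := stepped_src_vertices st sp ts te.
have [De|[x sx le]] := sp_dist sp aA eV; first by constructor 1.
exact: far_through st sp (far_a s x sr sx) le.
Qed.

Definition separated delta Y := {in Y &, forall x y, x != y -> delta <= d x y}.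

Lemma free_nsrc g E r b s : free g E r b -> s != inv_letter r -> ~~ src g E s b.
Proof.
move=> fr sr; apply/negP => /(fr s sr b)/(_ (lexx b))/barrierP[c _ /andP[bc cb]].
by move: bc; rewrite ltNge cb.
Qed.

Lemma separated_step D delta r u g E s g' E' rho : state (r :: u) g E ->
    apart D rho r u g E -> delta <= D -> separated delta (vertices g E) ->
    s != inv_letter r -> stepped D (r :: u) g E s g' E' ->
  separated delta (vertices g' E').
Proof.
move=> st ap dD sepV sr sp.
have vP x : x \in vertices g' E' -> x \in vertices g E \/
    exists a, [/\ a \in A, a \notin C & x = move g' s (run g (r :: u) a)].
  move=> /verticesP[t /(stepped_src st sp)[/src_vertices|[_ /mapP[a aA ->]]|[_ [a aA ->]]]].
  - by left.
  - by left; exact: run_vertices.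
  have [aC|aC] := boolP (a \in C); last by right; exists a.
  left; rewrite (C_run _ st aC) (C_move _ (sp_state sp) aC).
  exact: src_vertices (C_src (true, true) st aC).
have key a y : a \in A -> a \notin C -> y \in vertices g E ->
    delta <= d (move g' s (run g (r :: u) a)) y.
  move=> aA aC yV; have [De|[e se le]] := sp_dist sp aA yV; first exact: le_trans dD De.
  have be : run g (r :: u) a != e.
    by apply: contraTneq se => <-; exact: free_nsrc (ap a aA aC).1 sr.
  have := sepV _ _ (run_vertices st aA) (src_vertices se) be.
  by have := dist_ge0 (move g s e) y; lra.
move=> x y /vP[xV|[a [aA aC ->]]] /vP[yV|[a' [a'A a'C ->]]].
- exact: sepV.
- by move=> _; rewrite dC; exact: key.
- by move=> _; exact: key.
- rewrite dact => ne; apply: sepV; rewrite ?run_vertices//.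
  by apply: contraNneq ne => ->.
Qed.

(** The k-th image can miss the bound [rho + delta] from [y] only if [y] is the k-th
    image of a point with the same defect, along edges that were protected at the
    start: any other route through the amalgam costs an additional [delta]. *)
Lemma repeat_letter D delta rho r u g E t k : state (r :: u) g E -> reduced (r :: u) ->
    adm D -> diam_le D (vertices g E) -> delta <= D -> separated delta (vertices g E) ->
    apart D rho r u g E -> t.1 != r.1 ->
  exists g' E', let W := nseq k t in
    [/\ reduced (W ++ r :: u), state (W ++ r :: u) g' E', agree E g g' /\ sub_sources E E',
        diam_le D (vertices g' E') /\ separated delta (vertices g' E') &
    [/\ apart D rho (head r W) (behead (W ++ r :: u)) g' E',
        (forall e, src g' E' t e -> src g E t e \/ exists j a,
           [/\ (j < k)%N, a \in A & e = run g' (nseq j t) (run g (r :: u) a)]) &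
        forall a s y, a \in A -> a \notin C -> s != inv_letter (head r W) ->
          src g' E' s y -> ~ far D (rho + delta) (run g' (W ++ r :: u) a) y ->
          exists s0 y0, [/\ s0 != inv_letter r, src g E s0 y0,
            ~ far D (rho + delta) (run g (r :: u) a) y0,
            protected g E (nseq k t) y0 & y = run g (nseq k t) y0]]].
Proof.
move=> st red aD bD dD sepV ap tr.
elim: k => [|k [g1 [E1 [red1 st1 [gg1 sub1] [bD1 sep1] [ap1 src1 def1]]]]].
  exists g, E; split=> //; first by split=> //; exact: sub_refl.
  split=> // [e se|a s y aA aC sr sy nf]; first by left.
  by exists s, y; split=> //; rewrite run_nil.
set W := nseq k t in red1 st1 ap1 def1 *; set v := W ++ r :: u in red1 st1 ap1 def1 *.
have tW : t != inv_letter (head r W).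
  rewrite /W; case: (k) => [|k'] /=; last exact: neq_inv_letter.
  by apply: contraNneq tr => ->.
have vE : v = head r W :: behead v by rewrite /v /W; case: (k).
have st1' : state (head r W :: behead v) g1 E1 by rewrite -vE.
have [g2 [E2 sp]] := extend_word t st1 aD bD1.
have sp' : stepped D (head r W :: behead v) g1 E1 t g2 E2 by rewrite -vE.
have sub2 : sub_sources E1 E2 by rewrite (sp_edges sp); exact: sub_add_sources.
have runW j y0 : protected g1 E1 (nseq j t) y0 ->
    run g2 (nseq j t) y0 = run g1 (nseq j t) y0.
  by move=> /(protected_agree (sp_agree sp))[].
have trA j a : (j <= k)%N -> a \in A -> protected g1 E1 (nseq j t) (run g (r :: u) a).
  move=> jk aA; have := st_protected st1 aA; rewrite /v /W -(subnK jk) nseqD -catA protected_cat.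
  case/andP=> _; rewrite protected_cat => /andP[H _]; move: H.
  by have [_ ->] := protected_agree gg1 (st_protected st aA).
exists g2, E2 => /=; split.
- by rewrite -/v; apply: reduced_cons.
- exact: sp_state sp.
- by split; [exact: agree_trans gg1 sub1 (sp_agree sp)|exact: sub_trans sub1 sub2].
- by split; [exact: sp_diam sp|exact: separated_step st1' ap1 dD sep1 tW sp'].
split.
- by rewrite -/W -/v vE; exact: apart_step st1' ap1 tW sp'.
- move=> e /(stepped_src st1 sp)[/src1[se|[j [a [jk aA ->]]]]|[_ /mapP[a aA ->]]|[te]].
  + by left.
  + right; exists j, a; split=> //; first exact: ltnW.
    by rewrite runW// ?trA// ltnW.
  + right; exists k, a; split=> //; rewrite runW ?trA// /v run_cat.
    by have [_ ->] := protected_agree gg1 (st_protected st aA).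
  + by have := neq_inv_letter t; rewrite -te eqxx.
move=> a s y aA aC st' sy nf.
have yV := stepped_src_vertices st1 sp st' sy.
move: nf; rewrite -/W -/v (run_cons g2) (stepped_run st1 sp aA) => nf.
have [De|[e te le]] := sp_dist sp aA yV; first by case: nf; constructor 1.
have nfe : ~ far D (rho + delta) (run g1 v a) e.
  by move=> fe; apply: nf; exact: far_through st1 sp fe le.
have [s0 [y0 [s0r sy0 nf0 tr0 eE]]] := def1 a t e aA aC tW te nfe.
have se : src g E t e.
  case: (src1 e te) => // -[j [a' [jk a'A eE']]].
  have [a'C|a'C] := boolP (a' \in C).
    by rewrite eE' (C_run _ st a'C) (C_run _ st1 a'C); exact: C_src st a'C.
  exfalso.
  have [i kE] : exists i, k = (j + i.+1)%N by exists (k - j.+1)%N; rewrite addnS -addSn subnKC.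
  have : run g1 (nseq j t) (run g1 (nseq i.+1 t) y0) = run g1 (nseq j t) (run g (r :: u) a').
    rewrite -run_cat -nseqD -kE -eE' eE.
    by have [_ ->] := protected_agree gg1 tr0.
  move=> /act_inj; rewrite /= (run_cons g1).
  have tri : protected g E (nseq i.+1 t) y0.
    by move: tr0; rewrite /W kE nseqD protected_cat => /andP[].
  have /= /andP[sx tri'] := tri.
  have [_ ->] := protected_agree gg1 tri'.
  rewrite (agree_move gg1 sx) => posE.
  have := free_nsrc (ap a' a'A a'C).1 (s := inv_letter t).
  rewrite -posE src_move sx => /(_ _)/negP; apply=> //.
  by apply: contraNneq tr => /(can_inj inv_letterK) ->.
have te' : move g1 t e = move g t e := agree_move gg1 se.
exists s0, y0; split=> //=; first by rewrite -eE se tr0.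
rewrite run_cons -eE -te'; apply/eqP; rewrite eq_sym; apply: contrapT => /negP ne; apply: nf.
have := (ap1 a aA aC).2 t e tW te; rewrite -vE => -[De|re|[c cC ce]].
- by case: nfe; constructor 1.
- constructor 2; have := sep1 _ _ (move_vertices te) yV ne; lra.
- by case: nfe; constructor 3; exists c.
Qed.

Lemma run_nseq_fixed g t k y : move g t y = y -> run g (nseq k t) y = y.
Proof. by move=> ty; elim: k => [|k IH]; rewrite ?run_nil//= run_cons IH. Qed.

(** A point moved by an order automorphism has an infinite orbit, which cannot stay
    in a finite set. *)
Lemma long_run_fixed g E t k y : (size (vertices g E) < k)%N -> protected g E (nseq k t) y ->
  move g t y = y /\ src g E t y.
Proof.
move=> Vk tr; split; last first.
  case: k Vk tr => // k _; rewrite -addn1 nseqD protected_cat => /andP[_] /=.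
  by rewrite run_nil andbT.
apply: contrapT => /eqP ne.
pose p i := run g (nseq i t) y.
have pS i : p i.+1 = move g t (p i) by rewrite /p /= run_cons.
have p0 : p 0 = y by exact: run_nil.
have inj i j : (i < j)%N -> p i != p j.
  move=> ij; case: (ltgtP (move g t y) y) ne => // lt _.
    have dec n : p n.+1 < p n.
      by elim: n => [|n IH]; rewrite ?p0 ?[p 1]pS ?p0// (pS n.+1) {2}(pS n) lt_move.
    have trn x z x1 : x < z -> x1 < x -> x1 < z by move=> xz zx; exact: lt_trans zx xz.
    by rewrite eq_sym lt_eqF// (homo_ltn (r := fun x z => z < x) trn dec ij).
  have inc n : p n < p n.+1.
    by elim: n => [|n IH]; rewrite ?p0 ?[p 1]pS ?p0// (pS n.+1) {1}(pS n) lt_move.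
  have trn x z x1 : z < x -> x < x1 -> z < x1 by exact: lt_trans.
  by rewrite lt_eqF// (homo_ltn (r := fun x z => x < z) trn inc ij).
have pV i : (i < k)%N -> p i \in vertices g E.
  move=> ik; apply: (@src_vertices _ _ t); move: tr.
  by rewrite -(subnK ik) nseqD protected_cat => /andP[_] /= /andP[sp _]; exact: sp.
have p_inj : injective p.
  move=> i j /eqP pij; case: (ltngtP i j) => // /inj; first by rewrite pij.
  by rewrite eq_sym pij.
have un : uniq (map p (iota 0 k)) by rewrite map_inj_uniq ?iota_uniq.
have sb : {subset map p (iota 0 k) <= vertices g E}.
  by move=> x /mapP[i]; rewrite mem_iota => ik ->; exact: pV.
by have := uniq_leq_size un sb; rewrite size_map size_iota leqNgt Vk.
Qed.

Lemma fixed_generator g s y : move g s y = y -> act (g s.1) y = y.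
Proof.
case: s => i [] //= e; rewrite -[in LHS]e; exact: (moveVK g (i, true) y).
Qed.

(** A point that stays too close during a long power of one letter and then a long
    power of the other is fixed by both, hence is a common fixed point; but over
    common fixed points [far] holds trivially. *)
Lemma apart_increase D delta rho r u g E : state (r :: u) g E -> reduced (r :: u) ->
    adm D -> diam_le D (vertices g E) -> delta <= D -> separated delta (vertices g E) ->
    apart D rho r u g E ->
  exists W r' u' g' E', [/\ W ++ r :: u = r' :: u', reduced (r' :: u'), state (r' :: u') g' E',
    diam_le D (vertices g' E') /\ separated delta (vertices g' E') &
    apart D (rho + delta) r' u' g' E'].
Proof.
move=> st red aD bD dD sep ap; pose t : letter := (~~ r.1, true).
have tr : t.1 != r.1 by rewrite /t /=; case: r.1.
have [g1 [E1 [red1 st1 [gg1 sub1] [bD1 sep1] [ap1 _ def1]]]] :=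
  repeat_letter (size (vertices g E)).+1 st red aD bD dD sep ap tr.
set W1 := nseq _ t in red1 st1 ap1 def1.
have W1E : W1 ++ r :: u = t :: behead (W1 ++ r :: u) by [].
have hW1 : head r W1 = t by [].
rewrite hW1 in ap1 def1; rewrite W1E in st1 red1.
pose t' : letter := (r.1, true).
have tt' : t'.1 != t.1 by rewrite eq_sym.
have [g2 [E2 [red2 st2 _ [bD2 sep2] [ap2 _ def2]]]] :=
  repeat_letter (size (vertices g1 E1)).+1 st1 red1 aD bD1 dD sep1 ap1 tt'.
set W2 := nseq _ t' in red2 st2 ap2 def2.
have hW2 : head t W2 = t' by [].
exists (W2 ++ W1), t', (behead (W2 ++ t :: behead (W1 ++ r :: u))), g2, E2.
split=> //; first by rewrite -catA W1E.
move=> a aA aC; have [fra fara] := ap2 a aA aC; split=> // s e st' se.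
apply: contrapT => nf.
have [s0 [y0 [s0t sy0 nf0 tr0 eE]]] := def2 a s e aA aC st' se nf.
have [fix0 src0] := long_run_fixed (ltnSn _) tr0.
rewrite -W1E in nf0.
have [s1 [y1 [s1r sy1 nf1 tr1 y0E]]] := def1 a s0 y0 aA aC s0t sy0 nf0.
have [fix1 src1] := long_run_fixed (ltnSn _) tr1.
have y01 : y0 = y1.
  by rewrite y0E (run_nseq_fixed _ fix1).
rewrite -{}y01 {y0E tr1} in src1 fix1 sy1 nf1.
have y0C : y0 \notin C.
  apply/negP => y0C; apply: nf1; constructor 3; exists y0 => //.
  by rewrite dxx addr0.
have [f1 f0] : act (g1 true) y0 = y0 /\ act (g1 false) y0 = y0.
  have h1 := fixed_generator fix0.
  have h2 : act (g1 t.1) y0 = y0.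
    by apply: fixed_generator; rewrite (agree_move gg1 src1).
  by move: h1 h2; rewrite /t /t' /=; case: r.1.
have y0E : y0 \in E1 true.
  have h1 : y0 \in E1 t'.1 := src0.
  have h2 : y0 \in E1 t.1 by apply: sub1; exact: src1.
  by move: h1 h2; rewrite /t /t' /=; case: r.1.
by have := two_fixed st1 y0C y0E f1; rewrite f0 eqxx.
Qed.

Lemma separation_exists D Y : adm D ->
  exists delta n, [/\ delta <= D, separated delta Y & D <= delta *+ n].
Proof.
move=> aD; have [D0|D0] := ltP 0 D; last first.
  exists 0, 0%N; split; [exact: (adm_ge0 actP)|by move=> x y _ _ _; exact: dist_ge0|].
  by rewrite mulr0n.
pose L := [seq p <- allpairs pair Y Y | p.1 != p.2].
have [delta [d0 dD dL]] : exists delta, [/\ 0 < delta, delta <= D &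
    {in L, forall p, delta <= d p.1 p.2}].
  have : {in L, forall p, 0 < d p.1 p.2}.
    by move=> p; rewrite mem_filter => /andP[ne _]; exact: adm_dist actP _ aD D0 _ _ ne.
  elim: L => [|p L IH] pos; first by exists D.
  have [|delta [d0 dD dL]] := IH; first by move=> q qL; apply: pos; rewrite inE qL orbT.
  have p0 := pos p (mem_head _ _).
  exists (Num.min delta (d p.1 p.2)); split; first by rewrite lt_min d0.
    by rewrite ge_min dD.
  move=> q; rewrite inE => /orP[/eqP->|qL]; first by rewrite ge_min lexx orbT.
  by rewrite ge_min dL.
exists delta, (Num.bound (D / delta)%R); split=> // [x y xY yY ne|].
  by apply: (dL (x, y)); rewrite mem_filter ne; apply/allpairsP; exists (x, y).
have := archi_boundP (divr_ge0 (ltW D0) (ltW d0)); set n := Num.bound _ => /ltW.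
by rewrite ler_pdivrMr// mulr_natl.
Qed.

(** * Closing up a common word *)

(** The order and the distances of the images of [A] over all protected sources
    are those forced by the common fixed points. *)
Record ready D r u g E : Prop := Ready {
  rd_state : state (r :: u) g E ;
  rd_reduced : reduced (r :: u) ;
  rd_adm : adm D ;
  rd_diam : diam_le D (vertices g E) ;
  rd_apart : apart D D r u g E }.

Lemma ready_exists r u g E : state (r :: u) g E -> reduced (r :: u) ->
  exists W r' u' D g' E', W ++ r :: u = r' :: u' /\ ready D r' u' g' E'.
Proof.
move=> st red; have [W [g1 [E1 [red1 st1 fr1]]]] := all_free st red.
have [r1 [u1 [WE r1E]]] : exists r1 u1, W ++ r :: u = r1 :: u1 /\ r1 = head r W.
  by case: (W) => [|p w] /=; [exists r, u|exists p, (w ++ r :: u)].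
rewrite WE in red1 st1 fr1; rewrite -r1E in fr1.
have [D aD bD] := adm_bound actP (vertices g1 E1).
have [delta [n [dD sep Dn]]] := separation_exists (vertices g1 E1) aD.
suff [W' [r' [u' [g' [E' [WE' red' st' bD' ap']]]]]] : exists W' r' u' g' E',
    [/\ W' ++ r1 :: u1 = r' :: u', reduced (r' :: u'), state (r' :: u') g' E',
    diam_le D (vertices g' E') /\ separated delta (vertices g' E') & apart D (delta *+ n) r' u' g' E'].
  exists (W' ++ W), r', u', D, g', E'; rewrite -catA WE; split=> //; split=> //.
    exact: bD'.1.
  move=> a aA aC; have [fra far_a] := ap' a aA aC; split=> // s e sr se.
  case: (far_a s e sr se) => [De|de|ce]; [by constructor 1| |by constructor 3].
  by constructor 1; exact: le_trans Dn de.
elim: n {Dn} => [|n [W' [r' [u' [g' [E' [WE' red' st' [bD' sep'] ap']]]]]]].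
  exists [::], r1, u1, g1, E1; split=> // a aA aC; split; first exact: fr1.
  by move=> s e _ _; constructor 2; rewrite mulr0n; exact: dist_ge0.
have [W2 [r2 [u2 [g2 [E2 [WE2 red2 st2 b2 ap2]]]]]] := apart_increase st' red' aD bD' dD sep' ap'.
exists (W2 ++ W'), r2, u2, g2, E2; rewrite -catA WE' mulrSr; split=> //.
Qed.

Lemma ready_runs D r u g E W r' u' : ready D r u g E -> W ++ r :: u = r' :: u' ->
  reduced (r' :: u') -> exists g' E', ready D r' u' g' E'.
Proof.
move=> rd; elim: W r' u' => [|s W IH] r' u' /=; first by case=> <- <- _; exists g, E.
case=> <- {r'} <- {u'} red.
have [r1 [u1 WE]] : exists r1 u1, W ++ r :: u = r1 :: u1.
  by case: (W) => [|p w] /=; [exists r, u|exists p, (w ++ r :: u)].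
rewrite WE in red *; move: (red); rewrite /reduced /= => /andP[sr1 red1].
have [g1 [E1 [st1 _ aD bD ap1]]] := IH _ _ WE red1.
have [g2 [E2 sp]] := extend_word s st1 aD bD.
exists g2, E2; split=> //; first exact: sp_state sp.
- exact: sp_diam sp.
- exact: apart_step st1 ap1 sr1 sp.
Qed.

Definition close_up r u : word := inv_word (r :: u) ++ (~~ r.1, true) :: r :: u.

Lemma run_inv g w x : run g (inv_word w) (run g w x) = x.
Proof. by rewrite /run eval_inv_word actK. Qed.

(** Over the sources and the targets of the protected edges of the next generator
    the image of [A] has the same type, so the identity on it extends these edges
    to a partial automorphism. *)
Lemma ready_fix D r u g E : ready D r u g E ->
  exists g', agree (fun=> A) g0 g' /\ {in A, forall a, run g' (close_up r u) a = a}.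
Proof.
move=> [st red aD bD ap]; pose t : letter := (~~ r.1, true).
have tr q : (t.1, q) != inv_letter r.
  by apply/eqP => e; have := congr1 fst e; rewrite /t /=; case: r.1.
pose i := t.1; pose pos a := run g (r :: u) a.
have nE a : a \in A -> a \notin C -> pos a \notin E i.
  by move=> aA aC; have := free_nsrc (ap a aA aC).1 (tr true).
have notC a : pos a \notin E i -> a \notin C.
  by apply: contra => aC; rewrite /pos (C_run _ st aC) (st_sub st) ?C_sub_A.
have cE c : c \in C -> act (g i) c = c := fun cC => C_move (i, true) st cC.
have le1 a e : a \in A -> a \notin C -> e \in E i -> pos a <= e -> pos a < act (g i) e.
  move=> aA aC eE le; have [fra _] := ap a aA aC.
  have /barrierP[c cC /andP[bc ce]] := fra _ (tr true) e eE le.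
  by apply: lt_le_trans bc _; rewrite -(cE c cC) act_le.
have le2 a e : a \in A -> a \notin C -> e \in E i -> pos a <= act (g i) e -> pos a < e.
  move=> aA aC eE le; have [fra _] := ap a aA aC.
  have se' : src g E (i, false) (act (g i) e) by have := src_move g E (i, true) e; move=> ->.
  have /barrierP[c cC /andP[bc ce]] := fra _ (tr false) _ se' le.
  by apply: lt_le_trans bc _; rewrite -(act_le (g i)) (cE c cC).
have dE a e : a \in A -> a \notin C -> e \in E i -> d (pos a) (act (g i) e) = d (pos a) e.
  move=> aA aC eE; have [_ far_a] := ap a aA aC.
  have se : src g E (i, true) e by [].
  have se' : src g E (i, false) (act (g i) e) by have := src_move g E (i, true) e; move=> ->.
  have pV : pos a \in vertices g E := run_vertices st aA.
  have dc c : c \in C -> d c (act (g i) e) = d c e.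
    by move=> cC; rewrite -{1}(C_move (i, true) st cC) [LHS]dact.
  apply/eqP; rewrite eq_le; apply/andP; split.
    case: (far_a _ _ (tr true) se) => [De|De|[c cC ce]].
    - by apply: le_trans De; apply: bD => //; exact: src_vertices se'.
    - by apply: le_trans De; apply: bD => //; exact: src_vertices se'.
    - by have := dtri (pos a) c (act (g i) e); rewrite (dc c cC); move/le_trans; apply.
  case: (far_a _ _ (tr false) se') => [De|De|[c cC ce]].
  - by apply: le_trans De; apply: bD => //; exact: src_vertices se.
  - by apply: le_trans De; apply: bD => //; exact: src_vertices se.
  - by have := dtri (pos a) c e; rewrite (dc c cC) in ce; move/le_trans; apply.
pose f x := if x \in E i then act (g i) x else x.
pose L := E i ++ [seq pos a | a <- A & pos a \notin E i].
have LP x : x \in L -> x \in E i \/ x \notin E i /\ exists a, [/\ a \in A, a \notin C & x = pos a].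
  rewrite mem_cat => /orP[|/mapP[a]]; first by left.
  by rewrite mem_filter => /andP[naE aA] ->; right; split=> //; exists a; rewrite notC.
have [h hL] : exists h, {in L, act h =1 f}.
  apply: (act_homogeneous actP) => x y /LP[xE|[xE [a [aA aC xa]]]] /LP[yE|[yE [b [bA bC yb]]]];
    rewrite /f ?xE ?yE ?(negPf xE) ?(negPf yE)//.
  - rewrite yb !ltNge; congr negb.
    by apply/idP/idP => [/(le2 _ _ bA bC xE)|/(le1 _ _ bA bC xE)]; exact: ltW.
  - rewrite xa; apply/idP/idP => /ltW; first exact: le2.
    exact: le1.
  - by rewrite yb dC dE// dC.
  - by rewrite xa dE.
pose g' j := if j == i then h else g j.
have gg' : agree E g g'.
  move=> j x xE; rewrite /g'; case: eqP => // ji; rewrite ji in xE *.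
  by rewrite hL /f ?xE// mem_cat xE.
have st' := state_agree st gg'.
exists g'; split; first exact: st_agree st'.
move=> a aA; rewrite run_cat run_cons.
have [_ rE] := protected_agree gg' (st_protected st aA).
suff -> : move g' t (run g' (r :: u) a) = run g' (r :: u) a by exact: run_inv.
rewrite rE /move /eval_letter /= /g' eqxx -/(pos a).
have [pE|pE] := boolP (pos a \in E i); last first.
  rewrite hL /f ?(negPf pE)// mem_cat (negPf pE); apply: map_f.
  by rewrite mem_filter pE.
have aC : a \in C by apply: contraTT pE; exact: nE.
rewrite hL /f ?mem_cat pE //.
by rewrite /pos (C_run _ st aC); exact: (C_move (i, true) st aC).
Qed.

Lemma ready_move D r u g E a : ready D r u g E -> a \in A -> a \notin C ->
  exists g', agree (fun=> A) g0 g' /\ run g' (close_up r u) a != a.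
Proof.
move=> [st red aD bD ap] aA aC; pose t : letter := (~~ r.1, true).
have tr : t != inv_letter r.
  by apply/eqP => e; have := congr1 fst e; rewrite /t /=; case: r.1.
have [g' [E' sp]] := extend_word t st aD bD.
exists g'; split; first exact: st_agree (sp_state sp).
rewrite run_cat run_cons (stepped_run st sp aA); set b := run g (r :: u) a.
have bb : b < move g' t b.
  apply: (sp_lt sp aA); first exact: run_vertices.
  move=> e se /((ap a aA aC).1 t tr e se)/barrierP[c cC /andP[bc ce]].
  by apply: lt_le_trans bc _; rewrite -(C_move t st cC) le_move.
apply: contraTneq bb => e; rewrite -leNgt.
have : run g' (inv_word (r :: u)) (move g' t b) = run g' (inv_word (r :: u)) b.
  by rewrite e -[RHS](congr1 _ (stepped_run st sp aA)) run_inv.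
by move/act_inj => ->.
Qed.

Lemma state_exists u : exists g E, state u g E.
Proof.
elim: u => [|s u [g [E st]]].
  exists g0, (fun=> A); split=> //; last by move=> i e eA; exists e, [::]; rewrite run_nil.
  by move=> i.
have [D aD bD] := adm_bound actP (vertices g E).
by have [g' [E' sp]] := extend_word s st aD bD; exists g', E'; exact: sp_state sp.
Qed.

End Systems.

Definition pair_fun (G : Type) (p : G * G) (i : bool) : G := if i then p.1 else p.2.

Section CommonWord.
Context (disp : Order.disp_t) (X : orderType disp) (G : groupType).
Context (act : G -> X -> X) (d : X -> X -> rat) (adm : rat -> Prop).
Context (actP : homogeneous_action act d adm).
Implicit Types (A : seq X) (p : G * G).

Lemma common_ready A (S : seq (G * G)) : exists r u,
  {in S, forall p, exists D g E, ready act d adm A (pair_fun p) D r u g E}.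
Proof.
suff [r [u [_ H]]] : exists r u, reduced (r :: u) /\
    {in S, forall p, exists D g E, ready act d adm A (pair_fun p) D r u g E}.
  by exists r, u.
elim: S => [|p S [r [u [red IH]]]]; first by exists (true, true), [::].
have [g [E st]] := state_exists actP A (pair_fun p) (r :: u).
have [W [r' [u' [D [g' [E' [WE rd]]]]]]] := ready_exists actP st red.
exists r', u'; split; first exact: rd_reduced rd.
move=> q; rewrite inE => /orP[/eqP->|/IH[D1 [g1 [E1 rd1]]]]; first by exists D, g', E'.
have [g2 [E2 rd2]] := ready_runs actP rd1 WE (rd_reduced rd).
by exists D1, g2, E2.
Qed.

Definition agree_on A p q := forall i, {in A, act (pair_fun p i) =1 act (pair_fun q i)}.

(** The word [u] is prolonged for one pair after the other until all pairs are
    [ready] at once. *)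
Theorem common_word A (S1 S2 : seq (G * G)) :
  exists w, {in S1, forall p, exists2 q, agree_on A q p &
      {in A, forall a, act (word_eval (pair_fun q) w) a = a}} /\
    {in S2, forall p a, a \in A -> act p.1 a != a -> exists2 q, agree_on A q p &
      act (word_eval (pair_fun q) w) a != a}.
Proof.
have [r [u H]] := common_ready A (S1 ++ S2); exists (close_up r u).
have pf (g : bool -> G) : pair_fun (g true, g false) = g by apply/funext; case.
split=> p pS.
  have [|D [g [E rd]]] := H p; first by rewrite mem_cat pS.
  have [g' [ag fx]] := ready_fix actP rd.
  by exists (g' true, g' false); rewrite /agree_on pf.
move=> a aA pa; have [|D [g [E rd]]] := H p; first by rewrite mem_cat pS orbT.
have aC : a \notin common_fix act A (pair_fun p) by rewrite mem_filter /= (negPf pa).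
have [g' [ag mv]] := ready_move actP rd aA aC.
by exists (g' true, g' false); rewrite /agree_on pf.
Qed.

Lemma above_all (S : seq X) : exists a, {in S, forall y, y < a}.
Proof.
have [D aD bD] := adm_bound actP S; have D0 := adm_ge0 actP aD.
have [|y _|x y xS yS|z zP] := @one_point_extension _ _ _ _ _ _ actP D S pred0 (fun=> D) aD.
- by [].
- by split.
- have := bD x y xS yS; have := bD x x xS xS; rewrite (dist_refl actP) => _.
  by have := dist_ge0 actP x y; split; lra.
by exists z => y yS; have [_ _ ->] := zP y yS.
Qed.

Lemma movable_point A : exists a, forall p, exists2 q, agree_on A q p & act q.1 a != a.
Proof.
have [a aA] := above_all A; exists a => p.
have aN : a \notin A by apply/negP => /aA; rewrite ltxx.
have [D aD bD] := adm_bound actP (a :: A ++ map (act p.1) A).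
have [| |h [hE o _ _]] := push_up1 actP (Y := [:: a]) (h := p.1) aD aN.
- by move=> e eA; apply: bD; rewrite !inE ?eqxx// mem_cat eA orbT.
- have sb : {subset [:: a] ++ map (act p.1) A <= a :: A ++ map (act p.1) A}.
    by move=> x; rewrite !inE mem_cat => /orP[->//|->]; rewrite !orbT.
  by move=> x y /sb xY /sb yY; exact: bD.
exists (h, p.2); first by case.
have := o a (mem_head _ _); rewrite /= => ah; rewrite gt_eqF// ah// => e eA ae.
by have := aA e eA; rewrite ltNge ae.
Qed.

End CommonWord.

Local Close Scope order_scope.
Local Open Scope classical_set_scope.
Local Open Scope ring_scope.

(** * Category and similarity classes *)

Section Category.
Context (T : topologicalType).
Implicit Types (Z : set T).

Lemma nowhere_denseP Z :
  (forall p N, Z p -> nbhs p N -> exists2 q, N q &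
     exists2 W, nbhs q W & W `&` Z = set0) -> nowhere_dense Z.
Proof.
move=> H; apply/seteqP; split=> // p /= pZ.
have [q [Zq cq]] := interior_subset pZ _ (open_nbhs_nbhs (conj (@open_interior _ (closure Z)) pZ)).
have [r cr [W nW WZ]] := H q _ Zq (open_nbhs_nbhs (conj (@open_interior _ (closure Z)) cq)).
have [t [Zt Wt]] := interior_subset cr _ nW.
by have : (W `&` Z) t by []; rewrite WZ.
Qed.

Lemma meager_countable (I : countType) (F : I -> set T) Z :
  (forall i, nowhere_dense (F i)) -> Z `<=` \bigcup_i F i -> meager Z.
Proof.
move=> ndF ZF; exists (fun n => if unpickle n is Some i then F i else set0).
  move=> n; case: unpickle => [i|]; first exact: ndF.
  by rewrite /nowhere_dense closure0 interior0.
by move=> z /ZF[i _ Fz]; exists (pickle i) => //; rewrite pickleK.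
Qed.

Lemma meager_union3 (I J : countType) (F : I -> set T) (K : J -> set T) N Z :
  (forall i, nowhere_dense (F i)) -> (forall j, nowhere_dense (K j)) -> nowhere_dense N ->
  Z `<=` N `|` (\bigcup_i F i) `|` (\bigcup_j K j) -> meager Z.
Proof.
move=> ndF ndK ndN ZS.
pose L (s : option (I + J)) := match s with None => N | Some (inl i) => F i | Some (inr j) => K j end.
apply: (@meager_countable _ L); first by case=> [[]|].
move=> z /ZS[[Nz|[i _ Fz]]|[j _ Kz]]; [by exists None|by exists (Some (inl i))|by exists (Some (inr j))].
Qed.

End Category.

Section Similarity.
Context (H : groupTopologicalType).
Implicit Types (f g h : H * H) (w : word).

Lemma gen2_eval f w : gen2 f (word_eval (pair_fun f) w).
Proof.
move=> S [[S1 SM SV] fS]; have f1 : S f.1 by apply: fS; left.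
have f2 : S f.2 by apply: fS; right.
elim: w => [//|[i e] w IH] /=; apply: SM => //.
by case: i; case: e => //=; exact: SV.
Qed.

Lemma iso_eval f g phi w : bicontinuous_iso (gen2 f) (gen2 g) phi ->
  phi f.1 = g.1 -> phi f.2 = g.2 -> phi (word_eval (pair_fun f) w) = word_eval (pair_fun g) w.
Proof.
move=> [_ phiM _ _] f1 f2; have gen := @gen2_eval f.
have phi1 : phi 1%g = 1%g.
  have /= e := phiM _ _ (gen [::]) (gen [::]); rewrite mulg1 in e.
  by apply: (mulgI (phi 1%g)); rewrite -e mulg1.
have phiV x : gen2 f x -> gen2 f x^-1%g -> phi x^-1%g = (phi x)^-1%g.
  by move=> gx gx'; apply: (mulgI (phi x)); rewrite -phiM// !mulgV.
elim: w => [//|[i e] w IH] /=; rewrite phiM; last exact: gen.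
  rewrite IH; congr (_ * _)%g.
  have gi j : gen2 f (eval_letter (pair_fun f) (i, j)).
    by have := gen [:: (i, j)]; rewrite /= mulg1.
  have pi : phi (pair_fun f i) = pair_fun g i by case: (i).
  case: e; rewrite /eval_letter /= -pi//; apply: phiV; [exact: (gi true)|exact: (gi false)].
by have := gen [:: (i, e)]; rewrite /= mulg1.
Qed.

(** Both orbit maps of words factor through the group generated by [f], where the
    two isomorphisms are homeomorphisms onto their images. *)
Lemma similar_eval f g h (V : set H) : similarity_class2 f g -> similarity_class2 f h ->
  nbhs 1%g V -> exists2 U : set H, nbhs 1%g U &
    forall w, U (word_eval (pair_fun g) w) -> V (word_eval (pair_fun h) w).
Proof.
move=> [phi [iso_g g1 g2]] [chi [iso_h h1 h2]] nV.
have eg w := iso_eval w iso_g g1 g2; have eh w := iso_eval w iso_h h1 h2.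
have [_ _ _ [psi psiK cpsi]] := iso_g; have [_ _ cchi _] := iso_h.
have := cchi; rewrite subspace_continuousP => /(_ _ (@gen2_eval f [::])).
rewrite /from_subspace (eh [::]) => /(_ V nV) nU.
have := cpsi; rewrite subspace_continuousP => /(_ _ (@gen2_eval g [::])).
have psiE w : psi (word_eval (pair_fun g) w) = word_eval (pair_fun f) w.
  by rewrite -eg psiK// inE; exact: gen2_eval.
rewrite /from_subspace (psiE [::]) => /(_ _ nU) nU'.
exists (fun y => gen2 g y -> gen2 f (psi y) -> V (chi (psi y))) => //.
by move=> w /(_ (@gen2_eval g w)); rewrite psiE eh; apply; exact: gen2_eval.
Qed.

End Similarity.

(** * Small sets *)

Section Small.
Context dsp (T : measurableType dsp) (R : realType) (mu : {measure set T -> \bar R}).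
Implicit Types (e : R) (S : set T).

(** Outer measure less than e; this form applies to sets that are not known to be
    measurable. *)
Definition small e S := exists2 N, measurable N & S `<=` N /\ (mu N < e%:E)%E.

Lemma small_sub e S S' : S `<=` S' -> small e S' -> small e S.
Proof. by move=> SS' [N mN [S'N muN]]; exists N => //; split=> // x /SS' /S'N. Qed.

Lemma small_le e e' S : e <= e' -> small e S -> small e' S.
Proof.
move=> ee' [N mN [SN muN]]; exists N => //; split=> //.
by apply: lt_le_trans muN _; rewrite lee_fin.
Qed.

Lemma smallU e e' S S' : small e S -> small e' S' -> small (e + e') (S `|` S').
Proof.
move=> [N mN [SN muN]] [N' mN' [SN' muN']]; exists (N `|` N'); first exact: measurableU.
split; first by move=> x [/SN|/SN'] ?; [left|right].
apply: (le_lt_trans (measureU2 mu mN mN')).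
by rewrite EFinD; exact: lteD.
Qed.

Lemma small_ae e S S' : (\forall x \ae mu, S' x -> S x) -> small e S -> small e S'.
Proof.
move=> [N [mN N0 NS]] [K mK [SK muK]]; exists (K `|` N); first exact: measurableU.
split.
  move=> x S'x; have [Sx|nSx] := pselect (S x); first by left; exact: SK.
  by right; apply: NS => /= /(_ S'x).
apply: (le_lt_trans (measureU2 mu mK mN)).
by rewrite [X in (_ + X)%E](_ : _ = 0%E) // adde0.
Qed.

Lemma small_ae0 e S : 0 < e -> (\forall x \ae mu, ~ S x) -> small e S.
Proof.
move=> e0 nS; apply: (@small_ae _ set0); first by apply: filterS nS => x.
by exists set0 => //; split=> //; rewrite measure0 lte_fin.
Qed.

Lemma small_setT e : mu setT = 1%E -> e <= 1 -> ~ small e setT.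
Proof.
move=> mu1 e1 [N mN [TN muN]]; move: muN.
have -> : N = setT by apply/seteqP; split.
by rewrite mu1 lte_fin ltNge e1.
Qed.

End Small.

(** * Random pairs of automorphisms *)

Section RandomAutomorphisms.
Context dsp (T : measurableType dsp) (R : realType) (mu : {measure set T -> \bar R}).
Context (mu1 : mu setT = 1%E).
Context (L : Type) (M : relStructure L).
Local Notation H := (L0 mu (Aut M)).
Local Notation AutM := (Aut M : groupType).
Local Open Scope quotient_scope.
Implicit Types (f g h : H * H) (w : word) (A B : seq M) (e : R).

Lemma L0_word_eval (g : bool -> H) w : \forall x \ae mu,
  L0_fun (word_eval g w) x = word_eval (fun i => L0_fun (g i) x : Aut M) w.
Proof.
elim: w => [|[i e] w IH] /=; first exact: L0_fun1.
have Mw := L0_funM (eval_letter g (i, e)) (word_eval g w).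
have lw : \forall x \ae mu, L0_fun (eval_letter g (i, e)) x =
    eval_letter (fun i => L0_fun (g i) x : Aut M) (i, e).
  by case: e {Mw}; rewrite /eval_letter /=; [exact: aeW|exact: L0_funV].
by move: Mw IH lw; apply: filterS3 => x -> -> ->.
Qed.

Definition at_point f (x : T) : bool -> Aut M := pair_fun (L0_fun f.1 x, L0_fun f.2 x).

Lemma L0_word_eval2 f w : \forall x \ae mu,
  L0_fun (word_eval (pair_fun f) w) x = word_eval (at_point f x) w.
Proof.
have := L0_word_eval (pair_fun f) w; apply: filterS => x ->; congr word_eval.
by apply/funext; case.
Qed.

Definition agrees A (p q : bool -> Aut M) := forall i, {in A, p i =1 q i}.

Lemma agrees_sub A B (p q : bool -> Aut M) : {subset A <= B} -> agrees B p q -> agrees A p q.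
Proof. by move=> AB pq i a /AB; exact: pq. Qed.

Lemma finite_support (p : bool -> Aut M) w A : exists F : seq M, forall q,
  agrees F q p -> {in A, word_eval q w =1 word_eval p w}.
Proof.
have one a : exists F : seq M, forall q, agrees F q p -> word_eval q w a = word_eval p w a.
  elim: w => [|[i e] w [F HF]]; first by exists [::].
  pose y := word_eval p w a.
  exists ((if e then y else aut_inv (p i) y) :: F) => q qp.
  have qF : agrees F q p by apply: agrees_sub qp => b bF; rewrite inE bF orbT.
  have := qp i _ (mem_head _ _) => {qp}.
  have cons (q' : bool -> Aut M) : word_eval q' ((i, e) :: w) a =
    eval_letter q' (i, e) (word_eval q' w a) by [].
  rewrite !cons HF// -/y; case: e {cons} => //; rewrite /eval_letter.
  rewrite !aut_invE aut_invK => qy.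
  by rewrite -{1}qy aut_funK.
elim: A => [|a A [F HF]]; first by exists [::].
have [F' HF'] := one a; exists (F' ++ F) => q qp b; rewrite inE => /orP[/eqP->|bA].
  by apply: HF'; apply: agrees_sub qp => c cF; rewrite mem_cat cF.
by apply: HF bA; apply: agrees_sub qp => c cF; rewrite mem_cat cF orbT.
Qed.

Lemma small_measurable e S : measurable S -> small mu e S -> (mu S < e%:E)%E.
Proof.
move=> mS [N mN [SN muN]]; apply: le_lt_trans muN.
by apply: le_measure; rewrite ?inE.
Qed.

Lemma L0_difference (f g : H) : \forall x \ae mu,
  L0_fun (f^-1 * g)%g x = ((L0_fun f x : Aut M)^-1 * L0_fun g x)%g.
Proof.
by move: (L0_funM (f^-1)%g g) (L0_funV f); apply: filterS2 => x -> ->.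
Qed.

Lemma difference_fixes (a b : Aut M) A : {in A, (a^-1 * b)%g =1 id} <-> {in A, b =1 a}.
Proof.
split=> ab x xA; have := ab x xA; rewrite aut_mulE aut_invE.
  by move=> e; rewrite -{2}e aut_invK.
by move=> ->; rewrite aut_funK.
Qed.

Lemma open_agree (p : Aut M -> Prop) A :
  (forall a b : Aut M, {in A, a =1 b} -> p a -> p b) -> open (p : set (Aut M)).
Proof.
move=> pA; rewrite openE => a pa; apply/aut_nbhsP; exists A => b ba.
by apply: pA pa => x xA; rewrite ba.
Qed.

Lemma nbhs_small (f : H) (N : set H) : nbhs f N -> exists A e, 0 < e /\
  forall g : H, small mu e [set x | ~ {in A, (L0_fun g x : Aut M) =1 L0_fun f x}] -> N g.
Proof.
move=> [[V e] /= [[oV V1] e0] VN].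
have /aut_nbhsP[A AV] : nbhs (1%g : Aut M) V by exact: open_nbhs_nbhs.
exists A, e; split=> // g sm; apply: VN; rewrite /= /L0_ball /=.
apply: small_measurable; first exact: L0_fun_measurable.
apply: small_ae sm; apply: filterS (L0_difference f g) => x dx /=; rewrite dx => nV ag.
by apply: nV; apply: AV; exact/difference_fixes.
Qed.

Lemma small_nbhs A e (f : H) : 0 < e ->
  nbhs f [set g : H | small mu e [set x | ~ {in A, (L0_fun g x : Aut M) =1 L0_fun f x}]].
Proof.
move=> e0; pose V : set (Aut M) := [set a : Aut M | {in A, a =1 id}].
have oV : open V by apply: (@open_agree _ A) => a b ab aV x xA; rewrite -ab ?aV.
exists (V, e) => // g /= gV; rewrite /L0_ball /= in gV.
have : small mu e [set x | ~ V (L0_fun (f^-1 * g)%g x)].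
  by exists [set x | ~ V (L0_fun (f^-1 * g)%g x)]; [exact: L0_fun_measurable|split].
apply: small_ae; apply: filterS (L0_difference f g) => x dx /=; rewrite dx => nag fx.
by apply: nag; exact/difference_fixes.
Qed.

Definition near_on A e f g := small mu e [set x | ~ agrees A (at_point g x) (at_point f x)].

Lemma nbhs_near_on f N : nbhs f N -> exists A e, 0 < e /\
  forall g, near_on A e f g -> N g.
Proof.
case: f => f1 f2 [[P Q] /= [/nbhs_small[A1 [e1 [e10 P1]]] /nbhs_small[A2 [e2 [e20 Q2]]]] PQN].
exists (A1 ++ A2), (Num.min e1 e2); split; first by rewrite lt_min e10.
move=> [g1 g2] near_g; apply: PQN; split => /=.
  apply: P1; apply: (@small_le _ _ _ _ (Num.min e1 e2)); first by rewrite ge_min lexx.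
  by apply: small_sub near_g => x /= nag ag; apply: nag => a aA; apply: (ag true); rewrite mem_cat aA.
apply: Q2; apply: (@small_le _ _ _ _ (Num.min e1 e2)); first by rewrite ge_min lexx orbT.
by apply: small_sub near_g => x /= nag ag; apply: nag => a aA; apply: (ag false); rewrite mem_cat aA orbT.
Qed.

Lemma near_on_nbhs A e f : 0 < e -> nbhs f (near_on A e f).
Proof.
case: f => f1 f2 e0; have e20 : 0 < e / 2 by rewrite divr_gt0.
pose N (h : H) := [set g : H | small mu (e / 2)
  [set x | ~ {in A, (L0_fun g x : Aut M) =1 L0_fun h x}]].
exists (N f1, N f2); first by split; exact: small_nbhs.
move=> [g1 g2] /= [b1 b2]; rewrite /near_on [e]splitr.
apply: small_sub (smallU b1 b2) => x /= nag.
by apply: contrapT => /not_orP[/contrapT v1 /contrapT v2]; apply: nag; case.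
Qed.

(** The values of a pair on a finite set; there are only countably many of them,
    which makes random types measurable and almost finite. *)
Definition type_on A (p : Aut M * Aut M) : seq M * seq M := (map p.1 A, map p.2 A).

Lemma type_on_agrees A p q : type_on A p = type_on A q <-> agrees A (pair_fun p) (pair_fun q).
Proof.
split=> [[/eq_in_map e1 /eq_in_map e2] [] //|ag].
by congr pair; apply/eq_in_map => a aA; [exact: (ag true)|exact: (ag false)].
Qed.

Lemma type_measurable A f (S : set (seq M * seq M)) :
  measurable [set x | S (type_on A (L0_fun f.1 x, L0_fun f.2 x))].
Proof.
have m1 (h : H) (l : seq M) : measurable [set x | map (L0_fun h x : Aut M) A = l].
  apply: (borel_open (repr h : {mfun T >-> borel (Aut M)}) (U := [set a : Aut M | map a A = l])).
  apply: (@open_agree _ A) => a b ab <-; apply/eq_in_map => x xA.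
  by rewrite ab.
pose F k := if unpickle k is Some l then
  [set x | S l /\ type_on A (L0_fun f.1 x, L0_fun f.2 x) = l] else set0.
rewrite (_ : [set x | _] = \bigcup_k F k); last first.
  apply/seteqP; split=> x /= => [Sx|[k _]].
    by exists (pickle (type_on A (L0_fun f.1 x, L0_fun f.2 x))); rewrite // /F pickleK.
  by rewrite /F; case: unpickle => // l [Sl ->].
apply: bigcupT_measurable => k; rewrite /F; case: unpickle => // -[l1 l2].
have [Sl|nSl] := pselect (S (l1, l2)); last first.
  by rewrite (_ : [set x | _] = set0)//; apply/seteqP; split=> x // [].
rewrite (_ : [set x | _] = [set x | map (L0_fun f.1 x : Aut M) A = l1] `&`
  [set x | map (L0_fun f.2 x : Aut M) A = l2]); first exact: measurableI.
apply/seteqP; split=> x /= => [[_ [-> ->]]//|[e1 e2]].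
by split; rewrite // /type_on /= e1 e2.
Qed.

Lemma finitely_many_types A e f : 0 < e -> exists S : seq (seq M * seq M),
  small mu e [set x | type_on A (L0_fun f.1 x, L0_fun f.2 x) \notin S].
Proof.
move=> e0; pose t x := type_on A (L0_fun f.1 x, L0_fun f.2 x).
pose B n := [set x | (n <= pickle (t x))%N].
have mB n : measurable (B n) by exact: (type_measurable A f [set l | (n <= pickle l)%N]).
have : mu (B n) @[n --> \oo] --> mu (\bigcap_n B n).
  apply: nonincreasing_cvg_mu => //.
  - apply: (@le_lt_trans _ _ (mu setT)); first by apply: le_measure; rewrite ?inE.
    by rewrite mu1 ltry.
  - exact: bigcapT_measurable.
  - by move=> m n mn; apply/subsetPset => x; exact: leq_trans.
have -> : \bigcap_n B n = set0.
  apply/seteqP; split=> // x /(_ (pickle (t x)).+1 Logic.I).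
  by rewrite /B /= ltnn.
rewrite measure0 => /(_ [set y | (y < e%:E)%E]) [].
  by apply: open_nbhs_nbhs; split; [exact: open_ereal_lt_ereal|rewrite /= lte_fin].
move=> n _ /(_ n (leqnn n)) /= muB; exists (pmap unpickle (iota 0 n)).
exists (B n) => //; split=> // x /= tx; rewrite /B /= leqNgt; apply: contra tx => tn.
rewrite mem_pmap; apply/mapP; exists (pickle (t x)); first by rewrite mem_iota.
by rewrite pickleK.
Qed.

(** Random pairs are modified off a finite set by choosing a new value for each
    type. *)
Lemma of_type A f (s : seq M * seq M -> Aut M * Aut M) : exists g, \forall x \ae mu,
  (L0_fun g.1 x : Aut M, L0_fun g.2 x : Aut M) = s (type_on A (L0_fun f.1 x, L0_fun f.2 x)).
Proof.
have one (k : seq M * seq M -> Aut M) : exists h : H, \forall x \ae mu,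
    L0_fun h x = k (type_on A (L0_fun f.1 x, L0_fun f.2 x)).
  pose h0 x : borel (Aut M) := k (type_on A (L0_fun f.1 x, L0_fun f.2 x)).
  have mh : measurable_fun setT h0.
    apply: borel_measurable_fun => U oU.
    exact: (type_measurable A f [set l | U (k l)]).
  pose h : {mfun T >-> borel (Aut M)} := HB.pack h0 (isMeasurableFun.Build _ _ _ _ h0 mh).
  by exists (\pi_(H) h); exact: (L0_fun_pi mu h).
have [h1 H1] := one (fst \o s); have [h2 H2] := one (snd \o s).
exists (h1, h2); move: H1 H2; apply: filterS2 => x /= -> ->.
by case: (s _).
Qed.

Lemma finite_support_seq (I : eqType) (S : seq I) (s : I -> bool -> Aut M) w A :
  exists F : seq M, forall i (q : bool -> Aut M), i \in S -> agrees F q (s i) ->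
    {in A, word_eval q w =1 word_eval (s i) w}.
Proof.
elim: S => [|i S [F HF]]; first by exists [::].
have [F' HF'] := finite_support (s i) w A; exists (F' ++ F) => j q.
rewrite inE => /orP[/eqP->|jS] qs.
  by apply: HF'; apply: agrees_sub qs => c cF; rewrite mem_cat cF.
by apply: HF jS _; apply: agrees_sub qs => c cF; rewrite mem_cat cF orbT.
Qed.

Lemma agrees_trans A (p q r : bool -> Aut M) : agrees A p q -> agrees A q r -> agrees A p r.
Proof. by move=> pq qr i a aA; rewrite pq ?qr. Qed.

Lemma at_pointE f x p : (L0_fun f.1 x : Aut M, L0_fun f.2 x : Aut M) = p ->
  at_point f x = pair_fun p.
Proof. by move=> <-. Qed.

Lemma mem_agrees_type A B f x p : {subset A <= B} ->
  type_on B (L0_fun f.1 x, L0_fun f.2 x) = type_on B p -> agrees A (pair_fun p) (at_point f x).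
Proof. by move=> AB /esym/type_on_agrees; exact: agrees_sub. Qed.

Implicit Types (p q : Aut M * Aut M).

Context (word_extension : forall A (S1 S2 : seq (Aut M * Aut M)), exists w,
  {in S1, forall p, exists2 q, agrees A (pair_fun q) (pair_fun p) &
      {in A, forall a, word_eval (pair_fun q) w a = a}} /\
  {in S2, forall p a, a \in A -> p.1 a != a -> exists2 q,
      agrees A (pair_fun q) (pair_fun p) & word_eval (pair_fun q) w a != a}).
Context (movable_point : forall A, exists a, forall p : Aut M * Aut M,
  exists2 q : Aut M * Aut M, agrees A (pair_fun q) (pair_fun p) & q.1 a != a).

Definition moving g w A := [set x | ~ {in A, forall a, word_eval (at_point g x) w a = a}].

(** A pair outside all these sets has, for any other pair that moves [a], words that
    are close to 1 at it and can be made far from 1 at the other pair. *)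
Definition blind A n B a (S : seq (seq M * seq M)) : set (H * H) :=
  [set g | forall w, small mu n.+1%:R^-1 (moving g w A) ->
    ~ forall t, t \in S -> forall p, type_on (a :: B) p = t -> p.1 a != a ->
       exists2 q, type_on (a :: B) q = t & word_eval (pair_fun q) w a != a].

Lemma blind_nowhere_dense A n B a S : nowhere_dense (blind A n B a S).
Proof.
apply: nowhere_denseP => g0 N _ /nbhs_near_on[A1 [e [e0 gN]]].
pose A2 := A1 ++ A ++ a :: B; pose eps : R := n.+1%:R^-1.
have eps0 : 0 < eps by rewrite invr_gt0.
have sub1 : {subset A1 <= A2} by move=> b bA; rewrite mem_cat bA.
have subA : {subset A <= A2} by move=> b bA; rewrite !mem_cat bA orbT.
have subB : {subset a :: B <= A2} by move=> b bA; rewrite 2!mem_cat bA !orbT.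
pose e1 := Num.min e (eps / 2).
have e10 : 0 < e1 by rewrite lt_min e0 divr_gt0.
have [S1 smallS1] := finitely_many_types A2 g0 e10.
have /choice[rep repP] t : exists r, (exists p, type_on A2 p = t) -> type_on A2 r = t.
  have [[p pt]|np] := pselect (exists p, type_on A2 p = t).
    by exists p.
  by exists (1%g, 1%g).
have /choice[rep2 rep2P] t : exists r, (exists2 p, type_on (a :: B) p = t & p.1 a != a) ->
    type_on (a :: B) r = t /\ r.1 a != a.
  have [[p pt pa]|np] := pselect (exists2 p, type_on (a :: B) p = t & p.1 a != a).
    by exists p.
  by exists (1%g, 1%g).
have [w [w1 w2]] := word_extension A2 (map rep S1) (map rep2 S).
have /choice[s sP] t : exists q, t \in S1 -> agrees A2 (pair_fun q) (pair_fun (rep t)) /\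
    {in A2, forall a, word_eval (pair_fun q) w a = a}.
  have [tS|tS] := boolP (t \in S1); last by exists (1%g, 1%g).
  by have [q q1 q2] := w1 _ (map_f rep tS); exists q.
have [g gs] := of_type A2 g0 s.
pose t x := type_on A2 (L0_fun g0.1 x, L0_fun g0.2 x).
exists g.
  apply: gN; apply: (@small_le _ _ _ _ e1); first by rewrite ge_min lexx.
  apply: small_ae smallS1; apply: filterS gs => x /at_pointE gx /=.
  apply: contra_notN; rewrite -/(t x) => tS; rewrite gx.
  have [ag _] := sP _ tS; apply: (agrees_trans (agrees_sub sub1 ag)).
  by apply: (mem_agrees_type sub1); rewrite repP//; exists (L0_fun g0.1 x, L0_fun g0.2 x).
have [F HF] := finite_support_seq S1 (fun t => pair_fun (s t)) w A.
exists (near_on F (eps / 2) g); first by apply: near_on_nbhs; rewrite divr_gt0.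
apply/seteqP; split=> // g' [near_g' bad]; apply: (bad w).
  apply: (@small_le _ _ _ _ (e1 + eps / 2)).
    by rewrite -/eps [leRHS]splitr lerD2r ge_min lexx orbT.
  apply: small_ae (smallU smallS1 near_g'); apply: filterS gs => x /at_pointE gx /= mv.
  apply: contrapT => /not_orP[/negP/negPn tS /contrapT ag]; apply: mv => b bA.
  rewrite gx in ag; rewrite (HF _ _ tS ag)//.
  by have [_ fx] := sP _ tS; apply: fx; exact: subA.
move=> u uS p pu pa; have [|ru ra] := rep2P u; first by exists p.
have aA2 : a \in A2 by apply: subB; exact: mem_head.
have [q qr qa] := w2 _ (map_f rep2 uS) a aA2 ra.
exists q => //; rewrite -ru; apply/type_on_agrees; exact: agrees_sub qr.
Qed.

(** The topologies induced by g and h can only agree if h is dominated by g for some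
    [A] and [n].  The gap between 1/2 and 1/4 absorbs the errors made when h is
    approximated. *)
Definition dominated g A n a : set (H * H) :=
  [set h | small mu 2^-1 [set x | (L0_fun h.1 x : Aut M) a = a] /\
    forall w, small mu n.+1%:R^-1 (moving g w A) ->
      small mu 4^-1 [set x | word_eval (at_point h x) w a <> a]].

Lemma dominated_nowhere_dense g A n a : (forall A n B a S, ~ blind A n B a S g) ->
  nowhere_dense (dominated g A n a).
Proof.
move=> ng; apply: nowhere_denseP => h0 N [hlf _] /nbhs_near_on[A1 [e [e0 hN]]].
pose t x := type_on (a :: A1) (L0_fun h0.1 x, L0_fun h0.2 x).
have e10 : 0 < 16^-1 :> R by rewrite invr_gt0.
have [S smallS] := finitely_many_types (a :: A1) h0 e10.
have [w [gw wP]] : exists w, small mu n.+1%:R^-1 (moving g w A) /\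
    forall t, t \in S -> forall p, type_on (a :: A1) p = t -> p.1 a != a ->
      exists2 q, type_on (a :: A1) q = t & word_eval (pair_fun q) w a != a.
  apply: contrapT => nw; apply: (ng A n A1 a S) => w gw wP.
  by apply: nw; exists w.
have /choice[s sP] u : exists q, (exists p, type_on (a :: A1) p = u) ->
    type_on (a :: A1) q = u /\
    (u \in S -> (exists2 p, type_on (a :: A1) p = u & p.1 a != a) ->
      word_eval (pair_fun q) w a != a).
  have [[uS [p pu pa]]|no] := pselect (u \in S /\
      exists2 p, type_on (a :: A1) p = u & p.1 a != a).
    by have [q qu qa] := wP u uS p pu pa; exists q.
  have [[p pu]|np] := pselect (exists p, type_on (a :: A1) p = u).
    by exists p => _; split=> // uS up; case: no.
  by exists (1%g, 1%g) => up; case: np.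
have [h hs] := of_type (a :: A1) h0 s.
have tP x : exists p, type_on (a :: A1) p = t x by exists (L0_fun h0.1 x, L0_fun h0.2 x).
exists h.
  apply: hN; apply: small_ae0 => //; apply: filterS hs => x /at_pointE hx /=.
  apply; rewrite hx; apply: (@mem_agrees_type _ (a :: A1)).
    by move=> b bA; rewrite inE bA orbT.
  by have [-> _] := sP _ (tP x).
have [F HF] := finite_support_seq S (fun u => pair_fun (s u)) w [:: a].
exists (near_on F 16^-1 h); first exact: near_on_nbhs.
apply/seteqP; split=> // h' [near_h' [_ /(_ w gw) small_h']].
(* Otherwise four exceptional sets of total measure less than 1 cover the space. *)
apply: (@small_setT _ _ _ mu (2^-1 + 16^-1 + 16^-1 + 4^-1) mu1); first by lra.
apply: small_ae (smallU (smallU (smallU hlf smallS) near_h') small_h').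
apply: filterS hs => x /at_pointE hx _; apply: contrapT => /not_orP[/not_orP[/not_orP[]]].
move=> /= h0a /negP/negPn tS /contrapT ag /contrapT h'a; rewrite hx in ag.
have := HF _ _ tS ag a (mem_head _ _); rewrite h'a => wa.
have [_ /(_ tS) mv] := sP _ (tP x); rewrite -wa eqxx in mv.
suff : ~~ true by [].
by apply: mv; exists (L0_fun h0.1 x, L0_fun h0.2 x) => //; apply/eqP.
Qed.

(** Outside this set some point moves often enough for [dominated] to be of use. *)
Definition motionless : set (H * H) :=
  [set h | forall a, ~ small mu 2^-1 [set x | (L0_fun h.1 x : Aut M) a = a]].

Lemma motionless_nowhere_dense : nowhere_dense motionless.
Proof.
apply: nowhere_denseP => h0 N _ /nbhs_near_on[A [e [e0 hN]]].
have [a aP] := movable_point A.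
have /choice[s sP] u : exists q, q.1 a != a /\
    ((exists p, type_on A p = u) -> type_on A q = u).
  have [[p pu]|np] := pselect (exists p, type_on A p = u).
    have [q qp qa] := aP p; exists q; split=> // _; rewrite -pu.
    exact/type_on_agrees.
  by have [q _ qa] := aP (1%g, 1%g); exists q; split=> // up; case: np.
have [h hs] := of_type A h0 s; exists h.
  apply: hN; apply: small_ae0 => //; apply: filterS hs => x /at_pointE hx /=.
  apply; rewrite hx; apply: (@mem_agrees_type _ A) => //.
  have [_ ->] // := sP (type_on A (L0_fun h0.1 x, L0_fun h0.2 x)).
  by exists (L0_fun h0.1 x, L0_fun h0.2 x).
exists (near_on [:: a] 2^-1 h); first by apply: near_on_nbhs; rewrite invr_gt0.
apply/seteqP; split=> // h' [near_h' /(_ a)]; apply.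
apply: small_ae near_h'; apply: filterS hs => x /at_pointE hx /= h'a ag.
have := ag true a (mem_head _ _); rewrite hx /= h'a => sa.
by have [] := sP (type_on A (L0_fun h0.1 x, L0_fun h0.2 x)); rewrite -sa eqxx.
Qed.

(** If the class is not covered by the sets [blind], it has a member g outside all
    of them.  By [similar_eval] every member h that moves some point often enough
    is dominated by g. *)
Theorem similarity_class_meager f : meager (similarity_class2 f).
Proof.
pose K (i : seq M * nat * (seq M * M) * seq (seq M * seq M)) :=
  blind i.1.1.1 i.1.1.2 i.1.2.1 i.1.2.2 i.2.
have ndK i : nowhere_dense (K i) by exact: blind_nowhere_dense.
have [|/nonsubset[g [fg nKg]]] := pselect (similarity_class2 f `<=` \bigcup_i K i).
  exact: meager_countable.
have ng A n B a S : ~ blind A n B a S g.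
  by move=> bg; apply: nKg; exists (A, n, (B, a), S).
pose D (i : seq M * nat * M) := dominated g i.1.1 i.1.2 i.2.
apply: (@meager_union3 _ _ _ K D motionless) => // [i||h fh].
- exact: dominated_nowhere_dense.
- exact: motionless_nowhere_dense.
have [hm|] := pselect (motionless h); first by left; left.
move=> /existsNP[a /contrapT ha]; right.
pose V : set H := [set v | small mu 4^-1 [set x | (L0_fun v x : Aut M) a <> a]].
have nV : nbhs (1%g : H) V.
  have e0 : 0 < 4^-1 :> R by rewrite invr_gt0.
  apply: filterS (small_nbhs [:: a] 1%g e0) => v /=; apply: small_ae.
  have : \forall x \ae mu, L0_fun (1%g : H) x = 1%g := L0_fun1 mu (Aut M).
  apply: filterS => x x1 /= va ag; apply: va.
  by have := ag a (mem_head _ _); rewrite x1.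
have [U nU UV] := similar_eval fg fh nV.
have [A [e [e0 AU]]] := nbhs_small nU.
pose n := Num.bound e^-1.
exists (A, n, a) => //; split=> // w gw /=.
have Vh : V (word_eval (pair_fun h) w).
  apply: UV; apply: AU; apply: (@small_le _ _ _ _ n.+1%:R^-1).
    rewrite -[leRHS]invrK lef_pV2 ?posrE ?invr_gt0//.
    apply: le_trans (ltW (archi_boundP _)) _; first by rewrite invr_ge0 ltW.
    by rewrite ler_nat.
  apply: small_ae gw; have x1 : \forall x \ae mu, L0_fun (1%g : H) x = 1%g := L0_fun1 mu (Aut M).
  move: (L0_word_eval2 g w) x1; apply: filterS2 => x wx x1 /= nid id_x; apply: nid.
  by move=> b bA; rewrite wx x1 id_x.
apply: small_ae Vh; by apply: filterS (L0_word_eval2 h w) => x wx /=; rewrite wx.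
Qed.

End RandomAutomorphisms.

Lemma unit_lebesgue_setT (R : realType) : @unit_lebesgue R setT = 1%E.
Proof.
rewrite /unit_lebesgue range_unit_interval.
have := @lebesgue_measure_itv R `[0, 1]; rewrite /= lte_fin ltr01 oppr0 adde0.
by move=> <-.
Qed.

(** * The rational order *)

Section RationalOrder.

Definition rat_act (g : Aut ratOrder) (x : rat) : rat := g x.

Lemma dense_cut (S U : seq rat) : {in S & U, forall x y, x < y} ->
  exists z, {in S, forall x, x < z} /\ {in U, forall y, z < y}.
Proof.
elim: S => [_|x S IH SU].
  elim: U => [|y U [z [_ zU]]]; first by exists 0.
  exists (Num.min z (y - 1)); split=> // u; rewrite inE gt_min => /orP[/eqP->|/zU->//].
  by rewrite ltrBlDr ltrDl ltr01 orbT.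
have [|z [Sz zU]] := IH; first by move=> a b aS bU; apply: SU => //; rewrite inE aS orbT.
have [xz|zx] := ltP x z.
  by exists z; split=> // a; rewrite inE => /orP[/eqP->|/Sz].
have [w [xw wU]] : exists w, x < w /\ {in U, forall y, w < y}.
  have : {in U, forall y, x < y} by move=> y yU; apply: SU; rewrite ?mem_head.
  elim: (U) => [|y U' IHU] H; first by exists (x + 1); split=> //; rewrite ltrDl ltr01.
  have [|w [xw wU]] := IHU; first by move=> b bU; apply: H; rewrite inE bU orbT.
  have xy := H y (mem_head _ _).
  exists (Num.min w ((x + y) / 2)); split; first by rewrite lt_min xw midf_lt.
  by move=> b; rewrite inE gt_min => /orP[/eqP->|/wU->//]; rewrite (midf_lt xy) orbT.
exists w; split=> // a; rewrite inE => /orP[/eqP->//|/Sz az].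
by apply: lt_trans xw; exact: lt_le_trans az zx.
Qed.

Lemma rat_aut (f f' : rat -> rat) : cancel f f' -> cancel f' f ->
  {mono f : x y / x < y} -> exists g : Aut ratOrder, rat_act g = f.
Proof.
move=> fK f'K fm.
have fr l x y : @rel_of _ ratOrder l (f x) (f y) <-> @rel_of _ ratOrder l x y.
  by rewrite /= fm.
by exists (@MkAut _ ratOrder f f' fK f'K fr).
Qed.

Lemma rat_scaling (m a b : rat) : a < m -> b < m -> exists g : Aut ratOrder,
  (forall x, m <= x -> rat_act g x = x) /\ rat_act g a = b.
Proof.
move=> am bm; pose l := (m - b) / (m - a).
have l0 : 0 < l by rewrite divr_gt0 ?subr_gt0.
pose f k x : rat := if m <= x then x else m - k * (m - x).
have fK k : 0 < k -> cancel (f k) (f k^-1).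
  move=> k0 x; rewrite /f; case: (leP m x) => [->//|xm].
  have : ~~ (m <= m - k * (m - x)) by rewrite -ltNge ltrBlDr ltrDl mulr_gt0 ?subr_gt0.
  move=> /negPf ->; field; lra.
have fm : {mono f l : x y / x < y}.
  apply: leW_mono; apply: le_mono => x y xy; rewrite /f.
  case: (leP m x) => mx; case: (leP m y) => my //.
  - by have := lt_trans xy my; rewrite ltNge mx.
  - by apply: lt_le_trans my; rewrite ltrBlDr ltrDl mulr_gt0 ?subr_gt0.
  - by rewrite ltrD2l ltrN2 ltr_pM2l// ltrD2l ltrN2.
have [|g gE] := rat_aut (fK l l0) (f' := f l^-1) _ fm.
  by have := fK l^-1; rewrite invrK; apply; rewrite invr_gt0.
exists g; rewrite gE /f; split=> [x ->//|].
by rewrite leNgt am /= /l; field; rewrite subr_eq0 gt_eqF.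
Qed.

(** The points of [A] are matched from the largest one downwards; each new point is
    corrected by a map supported below the points that are already matched. *)
Lemma rat_homogeneous (A : seq rat) (f : rat -> rat) :
  {in A &, forall x y, (f x < f y) = (x < y)} ->
  exists g : Aut ratOrder, {in A, rat_act g =1 f}.
Proof.
move=> fA; pose S := sort <=%O (undup A).
have SA x : (x \in S) = (x \in A) by rewrite mem_sort mem_undup.
suff [g gS] : exists g : Aut ratOrder, {in S, rat_act g =1 f}.
  by exists g => x xA; apply: gS; rewrite SA.
have : {in S &, forall x y, (f x < f y) = (x < y)} by move=> x y; rewrite !SA; exact: fA.
have : sorted <%O S by rewrite lt_sorted_uniq_le sort_uniq undup_uniq sort_le_sorted.
elim: S {SA} => [|x [|m S] IH] sS fS.
- by exists 1%g.
- have [|g gE] := @rat_aut (fun y => y + (f x - x)) (fun y => y - (f x - x)) (addrK _) (subrK _).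
    by move=> y z; rewrite ltrD2r.
  by exists g => y; rewrite inE => /eqP->; rewrite gE; ring.
have {sS} /= /andP[xm sS] := sS.
have mS : {in m :: S, forall y, m <= y}.
  move=> y; rewrite inE => /orP[/eqP->//|yS].
  have := sS; rewrite (path_sortedE lt_trans) => /andP[/allP/(_ y yS)].
  by move=> /ltW.
have [|g gS] := IH sS; first by move=> y z yS zS; apply: fS; rewrite inE ?yS ?zS orbT.
have gm : rat_act g m = f m by apply: gS; exact: mem_head.
have glt y z : (rat_act g y < rat_act g z) = (y < z).
  have /= H := aut_rel g tt y z; by apply/idP/idP => /H.
have [||h [hid hx]] := @rat_scaling (f m) (rat_act g x) (f x).
- by rewrite -gm glt.
- by rewrite fS ?inE ?eqxx ?orbT.
exists (h * g)%g => y; rewrite inE => /orP[/eqP->|yS]; first exact: hx.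
have yS' : y \in [:: x, m & S] by rewrite inE yS orbT.
rewrite -[LHS]/(rat_act h (rat_act g y)) gS// hid// leNgt fS//.
  by rewrite -leNgt mS.
by rewrite !inE eqxx orbT.
Qed.

(** Since D = 0, the conditions on the prescribed distances force them to vanish. *)
Lemma rat_homogeneous_action :
  homogeneous_action rat_act (fun _ _ => 0) (fun D => D = 0).
Proof.
split=> //.
- by move=> g x y; have /= H := aut_rel g tt x y; apply/idP/idP => /H.
- by move=> D ->.
- by move=> S; exists 0.
- by move=> D ->; rewrite ltxx.
- by move=> A f fA _; exact: rat_homogeneous.
move=> D Y U f -> Uup fD ft.
have [|z [zL zU]] := @dense_cut [seq y <- Y | ~~ U y] [seq y <- Y | U y].
  move=> x y; rewrite !mem_filter => /andP[nUx xY] /andP[Uy yY].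
  rewrite ltNge; apply: contra nUx => yx; exact: Uup yx Uy.
exists z => y yY; split.
- by have [fy _] := fD y yY; have [_] := ft y y yY yY; lra.
- have [Uy|nUy] := boolP (U y); first by rewrite zU// mem_filter Uy.
  by rewrite lt_gtF// zL// mem_filter nUy.
- have [Uy|nUy] := boolP (U y); first by rewrite lt_gtF// zU// mem_filter Uy.
  by rewrite zL// mem_filter nUy.
Qed.

End RationalOrder.

Lemma rational_meager (R : realType)
    (f : L0 (@unit_lebesgue R) (Aut ratOrder) * L0 (@unit_lebesgue R) (Aut ratOrder)) :
  meager (similarity_class2 f).
Proof.
apply: similarity_class_meager; first exact: unit_lebesgue_setT.
- exact: (common_word rat_homogeneous_action).
- exact: (movable_point rat_homogeneous_action).
Qed.

(** * The ordered rational Urysohn space *)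

Section Urysohn.
Context (M : relStructure metricOrderLang) (QU : is_QU M).
Implicit Types (x y z : M) (S : seq M).

(** All properties of the order and of the distance of M are read off from its
    finite substructures, which belong to the age. *)
Definition sub_structure S : relStructure metricOrderLang :=
  @RelStructure _ (seq_sub S) (fun l (x y : seq_sub S) => rel_of l (val x) (val y)).

Lemma sub_structure_age S : finite_ordered_rational_metric_space (sub_structure S).
Proof.
apply/(QU.2 _); split; first exact: finite_finset.
by exists val; split; [exact: val_inj|].
Qed.

Definition lt_rel : rel M := fun x y => `[< @rel_of _ M LtSym x y >].

(** The rational q with [DistSym q] relating x and y; the default 0 is never used. *)
Definition qdist x y : rat := xget 0 [set q | @rel_of _ M (DistSym q) x y].

Lemma qdistP S : exists2 d : seq_sub S -> seq_sub S -> rat, is_metric d &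
  forall x y : seq_sub S, d x y = qdist (val x) (val y) /\
    forall q, @rel_of _ M (DistSym q) (val x) (val y) <-> qdist (val x) (val y) = q.
Proof.
have [_ _ [d md dP]] := sub_structure_age S; exists d => // x y.
have dq : d x y = qdist (val x) (val y).
  rewrite /qdist; case: xgetP => [q _ /= /(dP q x y)//|/(_ (d x y))].
  by case; apply/(dP (d x y) x y).
by split=> // q; rewrite -dq; exact: dP.
Qed.

Lemma lt_linear S : is_strict_linear_order (fun x y : seq_sub S => lt_rel (val x) (val y)).
Proof.
have [_ [irr tr tot] _] := sub_structure_age S; split.
- by move=> x /asboolP; exact: irr.
- by move=> x y z /asboolP xy /asboolP yz; apply/asboolP; exact: tr xy yz.
by move=> x y; case: (tot x y) => H; [constructor 1|constructor 2|constructor 3] => //; exact/asboolP.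
Qed.

Lemma lt_rel_irr : irreflexive lt_rel.
Proof.
move=> x; have [irr _ _] := lt_linear [:: x].
by apply/negP; exact: (irr (SeqSub (mem_head x [::]))).
Qed.

Lemma lt_rel_trans : transitive lt_rel.
Proof.
move=> y x z; have [_ tr _] := lt_linear [:: x; y; z].
have xS : x \in [:: x; y; z] by rewrite !inE eqxx.
have yS : y \in [:: x; y; z] by rewrite !inE eqxx orbT.
have zS : z \in [:: x; y; z] by rewrite !inE eqxx !orbT.
exact: (tr (SeqSub xS) (SeqSub yS) (SeqSub zS)).
Qed.

Lemma lt_rel_total x y : x != y -> lt_rel x y || lt_rel y x.
Proof.
move=> xy; have [_ _ tot] := lt_linear [:: x; y].
have xS : x \in [:: x; y] by rewrite !inE eqxx.
have yS : y \in [:: x; y] by rewrite !inE eqxx orbT.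
case: (tot (SeqSub xS) (SeqSub yS)) => /= [->//|[]|->]; last by rewrite orbT.
by move=> e; rewrite e eqxx in xy.
Qed.

Definition urysohn_order : orderType Order.default_display :=
  HB.pack (carrier M) (@Order.LtOrder.Build Order.default_display (carrier M) _ lt_rel _ _
    (fun _ _ => erefl) (fun _ _ => erefl) (fun _ _ => erefl)
    lt_rel_irr lt_rel_trans lt_rel_total).

Lemma qdist_metric : [/\ forall x, qdist x x = 0, forall x y, qdist x y = qdist y x,
  forall x y z, qdist x z <= qdist x y + qdist y z &
  forall x y, x != y -> 0 < qdist x y].
Proof.
split.
- move=> x; have [d [_ d0 _ _] dE] := qdistP [:: x].
  by rewrite -(dE (SeqSub (mem_head x [::])) (SeqSub (mem_head x [::]))).1; apply/d0.
- move=> x y; have [d [_ _ ds _] dE] := qdistP [:: x; y].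
  have xS : x \in [:: x; y] by rewrite !inE eqxx.
  have yS : y \in [:: x; y] by rewrite !inE eqxx orbT.
  rewrite -(dE (SeqSub xS) (SeqSub yS)).1 -(dE (SeqSub yS) (SeqSub xS)).1; exact: ds.
- move=> x y z; have [d [_ _ _ dt] dE] := qdistP [:: x; y; z].
  have xS : x \in [:: x; y; z] by rewrite !inE eqxx.
  have yS : y \in [:: x; y; z] by rewrite !inE eqxx orbT.
  have zS : z \in [:: x; y; z] by rewrite !inE eqxx !orbT.
  have := dt (SeqSub xS) (SeqSub yS) (SeqSub zS); rewrite !(dE _ _).1; exact: id.
move=> x y xy; have [d [dp d0 _ _] dE] := qdistP [:: x; y].
have xS : x \in [:: x; y] by rewrite !inE eqxx.
have yS : y \in [:: x; y] by rewrite !inE eqxx orbT.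
have e := (dE (SeqSub xS) (SeqSub yS)).1.
rewrite /= in e; rewrite -e lt_neqAle dp andbT eq_sym; apply: contra_neq xy.
by move=> /d0 /(congr1 val).
Qed.

Lemma qdist_rel q x y : @rel_of _ M (DistSym q) x y <-> qdist x y = q.
Proof.
have [d _ dE] := qdistP [:: x; y].
have xS : x \in [:: x; y] by rewrite !inE eqxx.
have yS : y \in [:: x; y] by rewrite !inE eqxx orbT.
exact: (dE (SeqSub xS) (SeqSub yS)).2.
Qed.

Definition one_point S (U : pred M) (f : M -> rat) : relStructure metricOrderLang :=
  @RelStructure _ (option (seq_sub S)) (fun l a b => match l, a, b with
    | LtSym, Some x, Some y => lt_rel (val x) (val y)
    | LtSym, Some x, None => ~~ U (val x)
    | LtSym, None, Some y => U (val y)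
    | LtSym, None, None => False
    | DistSym q, Some x, Some y => qdist (val x) (val y) = q
    | DistSym q, Some x, None => f (val x) = q
    | DistSym q, None, Some y => f (val y) = q
    | DistSym q, None, None => 0 = q
    end).

Lemma one_point_age S (U : pred M) (f : M -> rat) :
    {in S &, forall x y, lt_rel x y -> U x -> U y} ->
    {in S, forall y, 0 < f y} ->
    {in S &, forall x y, f x <= f y + qdist x y /\ qdist x y <= f x + f y} ->
  finite_ordered_rational_metric_space (one_point S U f).
Proof.
move=> Uup f0 ft; have [dxx ds dt dp] := qdist_metric.
have d0 x y : 0 <= qdist x y.
  by have [->|/dp/ltW//] := eqVneq x y; rewrite dxx.
split; first exact: finite_finset.
- split.
  + by move=> [x|] //=; rewrite lt_rel_irr.
  + move=> [x|] [y|] [z|] //=; try exact: lt_rel_trans.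
    * move=> xy nUy; apply: contra nUy => Ux; exact: (Uup (val x) (val y)) (valP _) (valP _) xy Ux.
    * move=> nUx Uz; have [xz|/lt_rel_total/orP[//|zx]] := eqVneq (val x) (val z).
        by rewrite xz Uz in nUx.
      by case/negP: nUx; exact: (Uup (val z) (val x)) (valP _) (valP _) zx Uz.
    * by move=> Uy yz; exact: (Uup (val y) (val z)) (valP _) (valP _) yz Uy.
    * by move=> ->.
  + move=> [x|] [y|] /=.
    * have [e|/lt_rel_total/orP[|]] := eqVneq (val x) (val y).
      - by constructor 2; congr Some; exact: val_inj.
      - by constructor 1.
      - by constructor 3.
    * by case: (U _); [constructor 3|constructor 1].
    * by case: (U _); [constructor 1|constructor 3].
    * by constructor 2.
pose D (a b : option (seq_sub S)) : rat := match a, b with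
  | Some x, Some y => qdist (val x) (val y) | Some x, None => f (val x)
  | None, Some y => f (val y) | None, None => 0 end.
exists D; last by move=> q [x|] [y|].
split.
- by move=> [x|] [y|] //=; apply: ltW; apply: f0; exact: valP.
- move=> [x|] [y|] //=; split=> //.
  + have [e _|/dp/gt_eqF/eqP//] := eqVneq (val x) (val y).
    by congr Some; exact: val_inj.
  + by case=> ->; rewrite dxx.
  + by move=> e; have := f0 _ (valP x); rewrite e ltxx.
  + by move=> e; have := f0 _ (valP y); rewrite e ltxx.
- by move=> [x|] [y|] //=; exact: ds.
move=> [x|] [y|] [z|] //=; rewrite ?addr0 ?add0r//.
- by have [] := ft _ _ (valP x) (valP y); rewrite addrC.
- by have [] := ft _ _ (valP x) (valP z).
- by have [] := ft _ _ (valP z) (valP y); rewrite ds.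
- by have := f0 _ (valP y); lra.
Qed.

Definition urysohn_act (g : Aut M) (x : urysohn_order) : urysohn_order := g x.

Lemma urysohn_homogeneous (A : seq M) (f : M -> M) :
  {in A &, forall x y, lt_rel (f x) (f y) = lt_rel x y} ->
  {in A &, forall x y, qdist (f x) (f y) = qdist x y} ->
  exists g : Aut M, {in A, g =1 f}.
Proof.
move=> fl fd; have [|||g gf] := @QU.1 [set` A] f.
- exact: finite_seq.
- move=> x y; rewrite !inE /= => xA yA fxy; apply/eqP; apply: contrapT => /negP.
  by case/lt_rel_total/orP; rewrite -fl// fxy lt_rel_irr.
- move=> [|q] x y /= xA yA.
    have := fl x y xA yA; rewrite /lt_rel => e.
    by split=> /asboolP H; apply/asboolP; [rewrite -e|rewrite e].
  by split=> /qdist_rel H; apply/qdist_rel; [rewrite -fd|rewrite fd].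
by exists g => x xA; exact: gf.
Qed.

Lemma aut_lt (g : Aut M) x y : lt_rel (g x) (g y) = lt_rel x y.
Proof. by apply: asbool_equiv_eq; exact: aut_rel. Qed.

Lemma aut_qdist (g : Aut M) x y : qdist (g x) (g y) = qdist x y.
Proof. by apply/qdist_rel/(aut_rel g (DistSym _)); exact/qdist_rel. Qed.

(** The finite space with one more point embeds in M; homogeneity moves the copy of
    [S] back to [S]. *)
Lemma urysohn_one_point S (U : pred M) (f : M -> rat) :
    {in S &, forall x y, lt_rel x y -> U x -> U y} ->
    {in S, forall y, 0 < f y} ->
    {in S &, forall x y, f x <= f y + qdist x y /\ qdist x y <= f x + f y} ->
  exists z, {in S, forall y, [/\ qdist z y = f y, lt_rel z y = U y & lt_rel y z = ~~ U y]}.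
Proof.
move=> Uup f0 ft; have [] := (QU.2 _).1 (one_point_age Uup f0 ft).
move=> _ [e [e_inj eP]].
pose e' x := if insub x is Some y then e (Some y) else x.
have e'E x (xS : x \in S) : e' x = e (Some (SeqSub xS)) by rewrite /e' insubT.
have [||g gE] := @urysohn_homogeneous S e'.
- move=> x y xS yS; rewrite !e'E; apply: asbool_equiv_eq.
  apply: iff_trans (eP LtSym _ _) _ => /=; rewrite /lt_rel; split=> [/asboolP|H]; first by [].
  exact/asboolP.
- move=> x y xS yS; rewrite !e'E; apply/qdist_rel.
  by apply/(eP (DistSym _)).
have bool_eq (P : Prop) (b : bool) : (P <-> b) -> `[< P >] = b.
  by move=> Pb; apply/idP/idP => [/asboolP/Pb|/Pb/asboolP].
exists ((g^-1)%g (e None)) => y yS.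
have gz : g ((g^-1)%g (e None)) = e None by rewrite aut_invE aut_invK.
have gy : g y = e (Some (SeqSub yS)) by rewrite gE// e'E.
split.
- by rewrite -(aut_qdist g) gz gy; apply/qdist_rel/(eP (DistSym _)).
- by rewrite -(aut_lt g) gz gy; apply: bool_eq; exact: (eP LtSym).
- by rewrite -(aut_lt g) gz gy; apply: bool_eq; exact: (eP LtSym).
Qed.

Lemma urysohn_homogeneous_action :
  homogeneous_action urysohn_act qdist (fun D => 0 < D).
Proof.
have [dxx ds dt dp] := qdist_metric; split=> //.
- by move=> g x y; exact: aut_lt.
- by move=> g x y; exact: aut_qdist.
- by move=> D; exact: ltW.
- move=> S; suff [D D0 DS] : exists2 D, 0 < D & {in allpairs pair S S, forall p, qdist p.1 p.2 <= D}.
    by exists D => // x y xS yS; apply: (DS (x, y)); apply/allpairsP; exists (x, y).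
  elim: (allpairs _ _ _) => [|p l [D D0 Dl]]; first by exists 1.
  exists (Num.max D (qdist p.1 p.2)); first by rewrite lt_max D0.
  by move=> q; rewrite inE le_max => /orP[/eqP->|/Dl->//]; rewrite lexx orbT.
- by move=> A h hl hd; exact: (@urysohn_homogeneous A h hl hd).
move=> D Y U f D0 Uup fD ft; apply: urysohn_one_point.
- by move=> x y xY yY xy; apply: Uup => //; exact: ltW.
- by move=> y yY; have [_ ->] := fD y yY.
- by move=> x y xY yY; exact: ft.
Qed.

Lemma urysohn_meager (R : realType)
    (f : L0 (@unit_lebesgue R) (Aut M) * L0 (@unit_lebesgue R) (Aut M)) :
  meager (similarity_class2 f).
Proof.
apply: similarity_class_meager; first exact: unit_lebesgue_setT.
- exact: (common_word urysohn_homogeneous_action).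
- exact: (movable_point urysohn_homogeneous_action).
Qed.

End Urysohn.

Theorem corollary4p18 (R : realType) :
  (forall f : L0 (@unit_lebesgue R) (Aut ratOrder)
              * L0 (@unit_lebesgue R) (Aut ratOrder),
     meager (similarity_class2 f)) /\
  (forall QU : relStructure metricOrderLang, is_QU QU ->
   forall f : L0 (@unit_lebesgue R) (Aut QU) * L0 (@unit_lebesgue R) (Aut QU),
     meager (similarity_class2 f)).
Proof.
split; first exact: rational_meager.
by move=> QU hQU f; exact: urysohn_meager.
Qed.
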